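(* Let $X=[x_1,\dots,x_N]\in\mathbb{R}^{L\times N}$ be a data matrix, where $N$ is the data size (number of samples) and $L$ is the feature length, and let $\gamma$ be a nonnegative parameter. Consider Nie's model $$\min_{A\in\mathbb{R}^{N\times N}}\ \left\|(X-XA)^{T}\right\|_{2,1}+\gamma\|A\|_{2,1}$$ and the two solvers for it, which update the columns $a_n$ of $A$, for all $n\in\{1,\dots,N\}$, by $$\text{(Nie's authorial solver)}\quad a_{n}=U_{nn}\left(U_{nn}X^{T}X+\gamma V\right)^{-1}X^{T}x_{n},$$ $$\text{(accelerated solver)}\quad a_n=U_{nn}\left(XV^{-1}\right)^{T}\left(U_{nn}X\left(XV^{-1}\right)^{T}+\gamma I_{L}\right)^{-1}x_{n}.$$ Since feature length is generally much smaller than data size, i.e. $L\ll N$, the accelerated solver for Nie's model is much faster than Nie's authorial solver. Theoretically, the computational complexity is reduced from $O(N^{4})$ to $O(N^{2}L+NL^{3})$, while maintaining the same solution. That is, like Nie's solver, the accelerated solver can reach the global optimum. (The statement adds that extensive empirical results will verify the huge acceleration.)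
   Context: For a matrix $Y$ with rows $y^l$, $\|Y\|_{2,1}=\sum_{l}\|y^{l}\|_2$. The vector $x_n$ is the $n$-th column of $X$; $a_n$ and $a^n$ are the $n$-th column and $n$-th row of $A$; $I_L$ is the $L\times L$ identity matrix. $V\in\mathbb{R}^{N\times N}$ is the diagonal matrix with diagonal entries $V_{nn}=\frac{1}{2\|a^n\|_2}$, and $U_{nn}=\frac{1}{2\|x_n-Xa_n\|_2}$. To avoid singular failures, these are computed as $V_{nn}=\frac{1}{2\sqrt{\|a^n\|_2^2+\epsilon}}$ and $U_{nn}=\frac{1}{2\sqrt{\|x_n-Xa_n\|_2^2+\epsilon}}$ with $\epsilon>0$; the algorithm then minimizes $\sum_{n=1}^N\sqrt{\|x_n-Xa_n\|_2^2+\epsilon}+\gamma\sum_{n=1}^N\sqrt{\|a^n\|_2^2+\epsilon}$, which reduces to the objective of Nie's model as $\epsilon\to 0$. Both solvers are iterative, and the complexities are those of one iteration step (updating all of $a_1,\dots,a_N$). For Nie's solver, the count $O(N^4)$ comes from solving, for each of the $N$ indices $n$, an $N\times N$ linear system by Cholesky factorization at cost $O(N^3)$. The objective of Nie's model is convex in $A$, and global optimality of Nie's solver is a result of its authors (Nie et al.). *)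

(* Defs.v *)
(* MathComp / MathComp-Analysis, over an arbitrary R : realType. *)
From HB Require Import structures.
From mathcomp Require Import all_boot all_order all_algebra.
From mathcomp Require Import all_classical all_reals all_analysis.

Set Implicit Arguments.
Unset Strict Implicit.
Unset Printing Implicit Defensive.

Import Order.TTheory GRing.Theory Num.Theory.
Import numFieldNormedType.Exports.

Local Open Scope classical_set_scope.
Local Open Scope ring_scope.

Definition norm2 (R : realType) (m n : nat) (y : 'M[R]_(m, n)) : R :=
  Num.sqrt (\sum_i \sum_j y i j ^+ 2).

Definition norm21 (R : realType) (m n : nat) (Y : 'M[R]_(m, n)) : R :=
  \sum_l norm2 (row l Y).

Definition nie_objective (R : realType) (L N : nat) (X : 'M[R]_(L, N))
    (gamma : R) (A : 'M[R]_N) : R :=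
  norm21 (X - X *m A)^T + gamma * norm21 A.

Definition residual (R : realType) (L N : nat) (X : 'M[R]_(L, N))
    (A : 'M[R]_N) (n : 'I_N) : 'cV[R]_L :=
  col n X - X *m col n A.

Definition smoothed_objective (R : realType) (L N : nat) (X : 'M[R]_(L, N))
    (gamma eps : R) (A : 'M[R]_N) : R :=
  \sum_n Num.sqrt (norm2 (residual X A n) ^+ 2 + eps)
  + gamma * \sum_n Num.sqrt (norm2 (row n A) ^+ 2 + eps).

Definition is_global_min (R : realType) (T : Type) (f : T -> R) (x : T) : Prop :=
  forall y, f x <= f y.

(* The parameter eps ranges over eps >= 0: eps = 0 gives the weights
   1 / (2 |a^n|) and 1 / (2 |x_n - X a_n|), eps > 0 the smoothed ones. *)
Definition Vmx (R : realType) (N : nat) (eps : R) (A : 'M[R]_N) : 'M[R]_N :=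
  diag_mx (\row_n (1 / (2 * Num.sqrt (norm2 (row n A) ^+ 2 + eps)))).

Definition Uw (R : realType) (L N : nat) (X : 'M[R]_(L, N)) (eps : R)
    (A : 'M[R]_N) (n : 'I_N) : R :=
  1 / (2 * Num.sqrt (norm2 (residual X A n) ^+ 2 + eps)).

(* No denominator of U and V vanishes; automatic when eps > 0. *)
Definition regular (R : realType) (L N : nat) (X : 'M[R]_(L, N)) (eps : R)
    (A : 'M[R]_N) : Prop :=
  forall n, norm2 (row n A) ^+ 2 + eps != 0 /\
            norm2 (residual X A n) ^+ 2 + eps != 0.

Definition nie_system (R : realType) (L N : nat) (X : 'M[R]_(L, N))
    (gamma eps : R) (A : 'M[R]_N) (n : 'I_N) : 'M[R]_N :=
  Uw X eps A n *: (X^T *m X) + gamma *: Vmx eps A.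

Definition nie_column (R : realType) (L N : nat) (X : 'M[R]_(L, N))
    (gamma eps : R) (A : 'M[R]_N) (n : 'I_N) : 'cV[R]_N :=
  Uw X eps A n *: (invmx (nie_system X gamma eps A n) *m X^T *m col n X).

Definition acc_system (R : realType) (L N : nat) (X : 'M[R]_(L, N))
    (gamma eps : R) (A : 'M[R]_N) (n : 'I_N) : 'M[R]_L :=
  Uw X eps A n *: (X *m (X *m invmx (Vmx eps A))^T) + gamma *: 1%:M.

Definition acc_column (R : realType) (L N : nat) (X : 'M[R]_(L, N))
    (gamma eps : R) (A : 'M[R]_N) (n : 'I_N) : 'cV[R]_N :=
  Uw X eps A n *: ((X *m invmx (Vmx eps A))^T
                     *m invmx (acc_system X gamma eps A n) *m col n X).

(* One iteration: U and V are computed from the current A, then all the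
   columns are replaced. *)
Definition nie_step (R : realType) (L N : nat) (X : 'M[R]_(L, N))
    (gamma eps : R) (A : 'M[R]_N) : 'M[R]_N :=
  \matrix_(i, n) nie_column X gamma eps A n i 0.

Definition acc_step (R : realType) (L N : nat) (X : 'M[R]_(L, N))
    (gamma eps : R) (A : 'M[R]_N) : 'M[R]_N :=
  \matrix_(i, n) acc_column X gamma eps A n i 0.

(* All the inverses occurring in an update exist. They always do for gamma > 0,
   but may fail to for gamma = 0; invmx is the identity on singular matrices. *)
Definition nie_defined (R : realType) (L N : nat) (X : 'M[R]_(L, N))
    (gamma eps : R) (A : 'M[R]_N) : Prop :=
  regular X eps A /\ forall n, nie_system X gamma eps A n \in unitmx.

Definition acc_defined (R : realType) (L N : nat) (X : 'M[R]_(L, N))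
    (gamma eps : R) (A : 'M[R]_N) : Prop :=
  regular X eps A /\ forall n, acc_system X gamma eps A n \in unitmx.

Definition run (T : Type) (step : T -> T) (A0 : T) (k : nat) : T :=
  iter k step A0.

(* A solver is given by its step and its definedness predicate, both depending
   on eps. The three clauses are: for eps > 0, every run converges to a global
   minimizer of the smoothed objective it minimizes; as eps tends to 0, the
   limits of these runs attain the optimal value of the original model,
   uniformly in the initial point; for eps = 0, any limit of a run at which no
   denominator vanishes is a global minimizer of the original model. *)
Definition reaches_global_optimum (R : realType) (L N : nat) (X : 'M[R]_(L, N))
    (gamma : R) (step : R -> 'M[R]_N -> 'M[R]_N)
    (defined : R -> 'M[R]_N -> Prop) : Prop :=
  [/\ forall (eps : R) (A0 : 'M[R]_N), 0 < eps ->
        (forall k, defined eps (run (step eps) A0 k)) ->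
        exists Aopt : 'M[R]_N, (run (step eps) A0 @ \oo --> Aopt) /\
          is_global_min (smoothed_objective X gamma eps) Aopt,
      forall eta : R, 0 < eta -> \forall eps \near (0 : R)^'+,
        forall A0 Aopt : 'M[R]_N,
        (forall k, defined eps (run (step eps) A0 k)) ->
        run (step eps) A0 @ \oo --> Aopt ->
        forall B, nie_objective X gamma Aopt <= nie_objective X gamma B + eta
    & forall A0 Aopt : 'M[R]_N,
        (forall k, defined 0 (run (step 0) A0 k)) ->
        run (step 0) A0 @ \oo --> Aopt -> regular X 0 Aopt ->
        is_global_min (nie_objective X gamma) Aopt].

(* Cost model: number of scalar operations +, -, *, / and sqrt. In the programs
   below every scalar operation goes through cadd, csub, cmul, cdiv or csqrt;
   reading, copying, transposing and assembling entries is free. *)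
Record counted (T : Type) : Type := Counted { value : T; cost : nat }.

Definition ret (T : Type) (x : T) : counted T := Counted x 0.

Definition bind (S T : Type) (c : counted S) (f : S -> counted T) : counted T :=
  Counted (value (f (value c))) (cost c + cost (f (value c))).

Notation "'let*' x := c 'in' d" := (bind c (fun x => d))
  (at level 200, x name, c at level 100, d at level 200).

Definition cadd (R : realType) (x y : R) : counted R := Counted (x + y) 1.
Definition csub (R : realType) (x y : R) : counted R := Counted (x - y) 1.
Definition cmul (R : realType) (x y : R) : counted R := Counted (x * y) 1.
Definition cdiv (R : realType) (x y : R) : counted R := Counted (x / y) 1.
Definition csqrt (R : realType) (x : R) : counted R := Counted (Num.sqrt x) 1.

Definition ctab (T : Type) (n : nat) (f : 'I_n -> counted T) :
    counted ('I_n -> T) :=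
  Counted (fun i => value (f i)) (\sum_i cost (f i)).

Definition cmatrix (R : realType) (m n : nat) (f : 'I_m -> 'I_n -> counted R) :
    counted 'M[R]_(m, n) :=
  Counted (\matrix_(i, j) value (f i j)) (\sum_i \sum_j cost (f i j)).

Definition csum (R : realType) (n : nat) (f : 'I_n -> counted R) : counted R :=
  foldr (fun i acc => let* s := acc in (let* x := f i in cadd x s))
        (ret 0) (enum 'I_n).

Definition cmulmx (R : realType) (m n p : nat) (A : 'M[R]_(m, n))
    (B : 'M[R]_(n, p)) : counted 'M[R]_(m, p) :=
  cmatrix (fun i k => csum (fun j => cmul (A i j) (B j k))).

Definition cscale (R : realType) (m n : nat) (a : R) (A : 'M[R]_(m, n)) :
    counted 'M[R]_(m, n) :=
  cmatrix (fun i j => cmul a (A i j)).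

(* Lower triangular factor C with A = C *m C^T, for A symmetric positive
   definite (outer-product form). *)
Fixpoint cholesky (R : realType) (n : nat) : 'M[R]_n -> counted 'M[R]_n :=
  match n return 'M[R]_n -> counted 'M[R]_n with
  | 0 => fun A => ret A
  | n'.+1 => fun A : 'M[R]_(1 + n') =>
      let* d := csqrt (ulsubmx A 0 0) in
      let* v := cmatrix (fun i (j : 'I_1) => cdiv (dlsubmx A i j) d) in
      let* S := cmatrix (fun i j =>
                  let* t := cmul (v i 0) (v j 0) in csub (drsubmx A i j) t) in
      let* C := cholesky S in
      ret (block_mx (d%:M : 'M[R]_1) 0 v C : 'M[R]_(1 + n'))
  end.

(* Solves C *m y = b for C lower triangular. *)
Fixpoint forward_subst (R : realType) (n : nat) :
    'M[R]_n -> 'cV[R]_n -> counted 'cV[R]_n :=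
  match n return 'M[R]_n -> 'cV[R]_n -> counted 'cV[R]_n with
  | 0 => fun _ b => ret b
  | n'.+1 => fun (C : 'M[R]_(1 + n')) (b : 'cV[R]_(1 + n')) =>
      let* y0 := cdiv (usubmx b 0 0) (ulsubmx C 0 0) in
      let* b' := cmatrix (fun i (j : 'I_1) =>
                   let* t := cmul (dlsubmx C i 0) y0 in
                   csub (dsubmx b i j) t) in
      let* y' := forward_subst (drsubmx C) b' in
      ret (col_mx (y0%:M : 'M[R]_1) y' : 'cV[R]_(1 + n'))
  end.

(* Solves C^T *m z = y for C lower triangular. *)
Fixpoint backward_subst (R : realType) (n : nat) :
    'M[R]_n -> 'cV[R]_n -> counted 'cV[R]_n :=
  match n return 'M[R]_n -> 'cV[R]_n -> counted 'cV[R]_n with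
  | 0 => fun _ y => ret y
  | n'.+1 => fun (C : 'M[R]_(1 + n')) (y : 'cV[R]_(1 + n')) =>
      let* z' := backward_subst (drsubmx C) (dsubmx y) in
      let* s := csum (fun k => cmul (dlsubmx C k 0) (z' k 0)) in
      let* t := csub (usubmx y 0 0) s in
      let* z0 := cdiv t (ulsubmx C 0 0) in
      ret (col_mx (z0%:M : 'M[R]_1) z' : 'cV[R]_(1 + n'))
  end.

Definition cholesky_solve (R : realType) (n : nat) (A : 'M[R]_n)
    (b : 'cV[R]_n) : counted 'cV[R]_n :=
  let* C := cholesky A in
  let* y := forward_subst C b in
  backward_subst C y.

(* 1 / (2 sqrt (|y|^2 + eps)) *)
Definition cweight (R : realType) (n : nat) (eps : R) (y : 'I_n -> R) :
    counted R :=
  let* s := csum (fun i => cmul (y i) (y i)) in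
  let* t := cadd s eps in
  let* r := csqrt t in
  let* d := cmul 2 r in
  cdiv 1 d.

Definition cVdiag (R : realType) (N : nat) (eps : R) (A : 'M[R]_N) :
    counted ('I_N -> R) :=
  ctab (fun n => cweight eps (fun j => A n j)).

Definition cUdiag (R : realType) (L N : nat) (X : 'M[R]_(L, N)) (eps : R)
    (A : 'M[R]_N) : counted ('I_N -> R) :=
  let* XA := cmulmx X A in
  let* E := cmatrix (fun i j => csub (X i j) (XA i j)) in
  ctab (fun n => cweight eps (fun i => E i n)).

(* X^T *m X is formed once per iteration and X^T *m x_n is read off as its n-th
   column. *)
Definition nie_prog (R : realType) (L N : nat) (X : 'M[R]_(L, N))
    (gamma eps : R) (A : 'M[R]_N) : counted 'M[R]_N :=
  let* v := cVdiag eps A in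
  let* u := cUdiag X eps A in
  let* G := cmulmx X^T X in
  let* w := ctab (fun i => cmul gamma (v i)) in
  let* a := ctab (fun n =>
    let* M := cmatrix (fun i j =>
                let* g := cmul (u n) (G i j) in
                if i == j then cadd g (w i) else ret g) in
    let* z := cholesky_solve M (col n G) in
    cscale (u n) z) in
  ret (\matrix_(i, n) a n i 0).

(* X *m V^-1 and X *m (X *m V^-1)^T are formed once per iteration. *)
Definition acc_prog (R : realType) (L N : nat) (X : 'M[R]_(L, N))
    (gamma eps : R) (A : 'M[R]_N) : counted 'M[R]_N :=
  let* v := cVdiag eps A in
  let* u := cUdiag X eps A in
  let* Y := cmatrix (fun i j => cdiv (X i j) (v j)) in
  let* H := cmulmx X Y^T in
  let* a := ctab (fun n =>
    let* M := cmatrix (fun i j =>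
                let* h := cmul (u n) (H i j) in
                if i == j then cadd h gamma else ret h) in
    let* z := cholesky_solve M (col n X) in
    let* q := cmulmx Y^T z in
    cscale (u n) q) in
  ret (\matrix_(i, n) a n i 0).

(* Main.v *)
(* The two updates agree by the push-through identity
   (u X^T X + g V) V^-1 X^T = X^T (u X V^-1 X^T + g I).

   Both iterations minimize at each step the quadratic majorizer
   sum_n u_n |x_n - X a_n|^2 + g sum_n v_n |a^n|^2 of the smoothed objective at
   the current point (for g = 0 the accelerated one does so under the constraint
   X A = X). The objective F decreases by at least a weighted square of the step,
   so the step tends to 0; the gradient at an iterate is a pairing with the step,
   and t |-> sqrt (|t|^2 + eps) is strongly convex on bounded sets, so
   |A_l - A_k|^2 <= C (F A_l - F A_k) + C' (F A_k - F A_k.+1)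
   and the iterates form a Cauchy sequence. Passing to the limit in the normal
   equations makes the limit a stationary point, hence a global minimizer by
   convexity; this last step also works for eps = 0 at a limit where no
   denominator vanishes. *)
Require Import Defs.
From HB Require Import structures.
From mathcomp Require Import all_boot all_order all_algebra.
From mathcomp Require Import all_classical all_reals all_analysis.
From mathcomp Require Import zify ring lra.

Set Implicit Arguments.
Unset Strict Implicit.
Unset Printing Implicit Defensive.

Import Order.TTheory GRing.Theory Num.Theory.
Import numFieldNormedType.Exports.

Local Open Scope classical_set_scope.
Local Open Scope ring_scope.

(** * Smoothed Euclidean norms and reweighted least squares *)

(** Vectors are functions on a finite type, so that rows of [A] and residuals, of different lengths,
    can later be padded onto one sum type. *)
Definition dotp (R : realType) (J : finType) (y z : J -> R) : R :=
  \sum_j y j * z j.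

Definition smooth (R : realType) (J : finType) (eps : R) (y : J -> R) : R :=
  Num.sqrt (dotp y y + eps).

Definition wsum (R : realType) (I J : finType) (eps : R) (c : I -> R)
    (Y : I -> J -> R) : R :=
  \sum_i c i * smooth eps (Y i).

Lemma dotp_ge0 (R : realType) (J : finType) (y : J -> R) : 0 <= dotp y y.
Proof. by apply: sumr_ge0 => j _; rewrite -expr2 sqr_ge0. Qed.

Lemma dotpC (R : realType) (J : finType) (y z : J -> R) : dotp y z = dotp z y.
Proof. by apply: eq_bigr => j _; rewrite mulrC. Qed.

Lemma dotpDr (R : realType) (J : finType) (x y z : J -> R) :
  dotp x (y + z) = dotp x y + dotp x z.
Proof. by rewrite -big_split; apply: eq_bigr => j _; rewrite mulrDr. Qed.

Lemma dotpDl (R : realType) (J : finType) (x y z : J -> R) :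
  dotp (x + y) z = dotp x z + dotp y z.
Proof. by rewrite dotpC dotpDr !(dotpC z). Qed.

Lemma dotpNr (R : realType) (J : finType) (x y : J -> R) :
  dotp x (- y) = - dotp x y.
Proof. by rewrite -sumrN; apply: eq_bigr => j _; rewrite mulrN. Qed.

Lemma dotpNl (R : realType) (J : finType) (x y : J -> R) :
  dotp (- x) y = - dotp x y.
Proof. by rewrite dotpC dotpNr dotpC. Qed.

Lemma dotpZr (R : realType) (J : finType) (a : R) (x y : J -> R) :
  dotp x (fun j => a * y j) = a * dotp x y.
Proof. by rewrite mulr_sumr; apply: eq_bigr => j _; rewrite mulrCA. Qed.

Lemma dotpZl (R : realType) (J : finType) (a : R) (x y : J -> R) :
  dotp (fun j => a * x j) y = a * dotp x y.
Proof. by rewrite dotpC dotpZr dotpC. Qed.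

Lemma dotp_le (R : realType) (J : finType) (y : J -> R) (j : J) :
  y j ^+ 2 <= dotp y y.
Proof.
rewrite /dotp (bigD1 j) //= expr2 lerDl.
by apply: sumr_ge0 => i _; rewrite -expr2 sqr_ge0.
Qed.

(* Lagrange's identity *)
Lemma dotp_CauchySchwarz (R : realType) (J : finType) (y z : J -> R) :
  dotp y z ^+ 2 <= dotp y y * dotp z z.
Proof.
have h : \sum_i \sum_j (y i * z j - y j * z i) ^+ 2
    = (dotp y y * dotp z z - dotp y z ^+ 2) *+ 2.
  rewrite mulr2n expr2 {1}[dotp y y * _]mulrC /dotp !big_distrlr /=.
  rewrite -!sumrB -!big_split /=; apply: eq_bigr => i _.
  rewrite -!sumrB -!big_split /=; apply: eq_bigr => j _.
  by ring.
rewrite -subr_ge0 -(pmulrn_lge0 _ (ltn0Sn 1)) -h.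
by apply: sumr_ge0 => i _; apply: sumr_ge0 => j _; rewrite sqr_ge0.
Qed.

(** Young's inequality, from [|y + t z|^2 / t >= 0]. *)
Lemma dotp_AMGM (R : realType) (J : finType) (t : R) (y z : J -> R) :
  0 < t -> - (dotp y y / t + t * dotp z z) <= 2 * dotp y z.
Proof.
move=> t0; have t0' : t != 0 by rewrite gt_eqF.
rewrite -subr_ge0.
have -> : 2 * dotp y z - - (dotp y y / t + t * dotp z z)
    = t^-1 * dotp (y + (fun j => t * z j)) (y + (fun j => t * z j)).
  by rewrite !dotpDl !dotpDr !dotpZl !dotpZr (dotpC z y); field.
by apply: mulr_ge0; [rewrite invr_ge0 ltW | exact: dotp_ge0].
Qed.

Lemma smooth_ge0 (R : realType) (J : finType) (eps : R) (y : J -> R) :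
  0 <= smooth eps y.
Proof. exact: sqrtr_ge0. Qed.

Lemma smooth_gt0 (R : realType) (J : finType) (eps : R) (y : J -> R) :
  0 < eps -> 0 < smooth eps y.
Proof. by move=> e0; rewrite sqrtr_gt0 ltr_wpDl // dotp_ge0. Qed.

Lemma sqr_smooth (R : realType) (J : finType) (eps : R) (y : J -> R) :
  0 <= eps -> smooth eps y ^+ 2 = dotp y y + eps.
Proof. by move=> e0; rewrite sqr_sqrtr // addr_ge0 // dotp_ge0. Qed.

(** Cauchy-Schwarz for [y] and [z] extended by one coordinate [sqrt eps]; the two sides differ
    exactly by [|y|^2 |z|^2 - (y.z)^2]. *)
Lemma smooth_mul_ge (R : realType) (J : finType) (eps : R) (y z : J -> R) :
  0 <= eps ->
  (dotp y z + eps) ^+ 2 + eps * dotp (z - y) (z - y)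
    <= (smooth eps y * smooth eps z) ^+ 2.
Proof.
move=> e0; rewrite exprMn !sqr_smooth //.
rewrite !dotpDl !dotpDr !dotpNl !dotpNr (dotpC z y).
have := dotp_CauchySchwarz y z.
move: (dotp y z) (dotp y y) (dotp z z) => b a d h; nra.
Qed.

(** Convexity in gradient form, the gradient at [y] being [y / smooth eps y]. After multiplication
    by [smooth eps y] it is the Cauchy-Schwarz bound above. *)
Lemma smooth_tangent (R : realType) (J : finType) (eps : R) (y z : J -> R) :
  0 <= eps -> 0 < smooth eps y ->
  smooth eps y + dotp y z / smooth eps y <= smooth eps (y + z).
Proof.
move=> e0 h0; rewrite -(ler_pM2l h0) mulrDr mulrCA divff ?gt_eqF // mulr1.
rewrite -expr2 sqr_smooth //.
have := smooth_mul_ge y (y + z) e0.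
have : 0 <= eps * dotp (y + z - y) (y + z - y) by rewrite mulr_ge0 ?dotp_ge0.
rewrite (dotpDr y).
have := mulr_ge0 (smooth_ge0 eps y) (smooth_ge0 eps (y + z)).
move: (_ * smooth _ _) (eps * _) => p d p0 d0 hp.
have : (dotp y y + dotp y z + eps) ^+ 2 <= p ^+ 2 by lra.
(* The left side may be negative, so it passes to its absolute value before squares are compared. *)
move=> h; rewrite addrAC; apply: le_trans (ler_norm _) _.
rewrite -(ger0_norm p0).
by rewrite -ler_sqr ?nnegrE // -!normrX !ger0_norm ?sqr_ge0.
Qed.

(** Put [p = smooth y * smooth (y + z)] and [s = y.(y + z) + eps]. Then [p^2 - s^2 >= eps |z|^2],
    and [2 p (p - s) >= p^2 - s^2] since the difference is [(p - s)^2]. The modulus of convexity is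
    uniform on bounded sets only. *)
Lemma smooth_strong_tangent (R : realType) (J : finType) (eps : R)
    (y z : J -> R) :
  0 < eps ->
  smooth eps y + dotp y z / smooth eps y
    + eps * dotp z z / (2 * smooth eps y ^+ 2 * smooth eps (y + z))
  <= smooth eps (y + z).
Proof.
move=> e0; have := smooth_mul_ge y (y + z) (ltW e0).
have := sqr_smooth y (ltW e0).
have := smooth_gt0 y e0; have := smooth_gt0 (y + z) e0.
rewrite addrAC subrr add0r dotpDr.
move: (smooth eps y) (smooth _ _) => h g g0 h0 sh hp.
rewrite -subr_ge0.
have hn : h != 0 by rewrite gt_eqF.
have gn : g != 0 by rewrite gt_eqF.
have -> : g - (h + dotp y z / h + eps * dotp z z / (2 * h ^+ 2 * g))
  = (2 * (h * g) * (h * g - (h ^+ 2 + dotp y z)) - eps * dotp z z)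
      / (2 * h ^+ 2 * g) by field; rewrite hn gn.
apply: divr_ge0; last by rewrite !mulr_ge0 // ?exprn_ge0 // ltW.
rewrite sh; move: hp; move: (h * g) (eps * _) (dotp y y) (dotp y z) => p d a b.
move=> hp; have := sqr_ge0 (p - (a + b + eps)); nra.
Qed.

(* Concavity of the square root: |y|^2 / (2 h) + h / 2 majorizes smooth. *)
Lemma smooth_majorize (R : realType) (J : finType) (eps : R) (a b : J -> R) :
  0 < eps ->
  smooth eps b + dotp (a - b) (a - b) / (2 * smooth eps a)
    + dotp b (a - b) / smooth eps a <= smooth eps a.
Proof.
move=> e0; have := sqr_smooth a (ltW e0); have := sqr_smooth b (ltW e0).
have := smooth_gt0 a e0; move: (smooth eps a) (smooth eps b) => h g h0 gE hE.
have hn : h != 0 by rewrite gt_eqF.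
rewrite -subr_ge0 !dotpDl !dotpDr !dotpNl !dotpNr (dotpC b a).
have -> : dotp a a = h ^+ 2 - eps by lra.
have -> : dotp b b = g ^+ 2 - eps by lra.
have -> : h - (g + (h ^+ 2 - eps - dotp a b + (- dotp a b - - (g ^+ 2 - eps)))
      / (2 * h) + (dotp a b - (g ^+ 2 - eps)) / h)
  = (h - g) ^+ 2 / (2 * h) by field.
by rewrite divr_ge0 ?sqr_ge0 // mulr_ge0 // ltW.
Qed.

(** * Convergence of iteratively reweighted least squares *)

Lemma cauchy_sequence_cvgn (R : realType) (u : nat -> R) :
  (forall e, 0 < e -> exists K, forall k l,
     (K <= k)%N -> (K <= l)%N -> `|u k - u l| < e) ->
  cvgn u.
Proof.
move=> h; apply: cauchy_cvg; apply: cauchy_exP => e /h[K hK].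
exists (u K); exists K => // k /= Kk.
exact: hK.
Qed.

(** First-order condition at [Y'], in the direction [Z], for the quadratic majorizer whose weights
    are frozen at [Y]. *)
Definition stationary_step (R : realType) (I J : finType) (eps : R)
    (c : I -> R) (Y Y' Z : I -> J -> R) : Prop :=
  \sum_i c i * (dotp (Y' i) (Z i) / smooth eps (Y i)) = 0.

(** Sum of [smooth_majorize] over the rows; the cross terms add up to zero by stationarity. *)
Lemma stationary_step_descent (R : realType) (I J : finType) (eps : R)
    (c : I -> R) (Y Y' : I -> J -> R) :
  0 < eps -> (forall i, 0 <= c i) -> stationary_step eps c Y Y' (Y - Y') ->
  wsum eps c Y'
    + \sum_i c i * (dotp (Y i - Y' i) (Y i - Y' i) / (2 * smooth eps (Y i)))
  <= wsum eps c Y.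
Proof.
move=> e0 c0 st; rewrite -[leLHS]addr0 -[X in _ + X]st -!big_split /=.
apply: ler_sum => i _; rewrite -!mulrDr ler_wpM2l //.
exact: smooth_majorize.
Qed.

Lemma smooth_le_wsum (R : realType) (I J : finType) (eps : R) (c : I -> R)
    (Y : I -> J -> R) (i : I) :
  (forall i, 0 < c i) -> smooth eps (Y i) <= wsum eps c Y / c i.
Proof.
move=> c0; rewrite ler_pdivlMr // mulrC /wsum (bigD1 i) //= lerDl.
by apply: sumr_ge0 => k _; rewrite mulr_ge0 ?smooth_ge0 // ltW.
Qed.

(* The stationarity of the step from Y to Y' replaces the gradient of the
   objective at Y by a pairing with Y - Y', which is absorbed by half of the
   strong convexity term. *)
Lemma stationary_step_strong (R : realType) (I J : finType) (eps H : R)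
    (c : I -> R) (Y Y' W : I -> J -> R) :
  0 < eps -> 0 < H -> (forall i, 0 <= c i) ->
  (forall i, smooth eps (Y i) <= H) -> (forall i, smooth eps (W i) <= H) ->
  stationary_step eps c Y Y' (W - Y) ->
  wsum eps c Y
    + eps / (4 * H ^+ 3) * \sum_i c i * dotp (W i - Y i) (W i - Y i)
    - 2 * H ^+ 2 / eps *
      \sum_i c i * (dotp (Y i - Y' i) (Y i - Y' i) / (2 * smooth eps (Y i)))
  <= wsum eps c W.
Proof.
move=> e0 H0 c0 YH WH st; rewrite -[leLHS]addr0 -[X in _ + X <= _]st.
rewrite !mulr_sumr -sumrN -!big_split /=.
apply: ler_sum => i _.
rewrite (mulrCA _ (c i)) (mulrCA _ (c i)) -mulrN -!mulrDr ler_wpM2l //.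
have := smooth_strong_tangent (Y i) (W i - Y i) e0.
(* With this weight, Young's inequality costs [eps |W - Y|^2 / (4 h H^2)], where
   [h = smooth eps (Y i)]: half of the strong convexity term once [h] and [g] are bounded by [H] as
   in [b_ge]. *)
have t0 : 0 < eps / (2 * H ^+ 2) by rewrite divr_gt0 ?mulr_gt0 ?exprn_gt0.
have := dotp_AMGM (Y i - Y' i) (W i - Y i) t0.
have -> : Y i + (W i - Y i) = W i by rewrite addrC subrK.
change ((W - Y) i) with (W i - Y i).
have -> : dotp (Y' i) (W i - Y i) = dotp (Y i) (W i - Y i)
    - dotp (Y i - Y' i) (W i - Y i).
  by rewrite [dotp (_ - _) _]dotpDl dotpNl opprD opprK addNKr.
have := dotp_ge0 (Y i - Y' i); have := dotp_ge0 (W i - Y i).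
have := smooth_gt0 (Y i) e0; have := smooth_gt0 (W i) e0.
have := YH i; have := WH i.
move: (smooth eps (Y i)) (smooth eps (W i)) => h g gH hH g0 h0.
move: (dotp _ _) (dotp _ _) => a b.
move: (dotp _ _) (dotp _ _) => p q b0 a0 amgm strong.
have hn : h != 0 by rewrite gt_eqF.
have gn : g != 0 by rewrite gt_eqF.
have Hn : H != 0 by rewrite gt_eqF.
have en : eps != 0 by rewrite gt_eqF.
apply: le_trans strong; rewrite -subr_ge0.
have q_ge : - (a / (eps / (2 * H ^+ 2)) + eps / (2 * H ^+ 2) * b) / (2 * h)
    <= q / h.
  rewrite ler_pdivrMr ?mulr_gt0 //.
  by have -> : q / h * (2 * h) = 2 * q by field.
have b_ge : eps * b / (2 * h * H ^+ 2) <= eps * b / (2 * h ^+ 2 * g).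
  rewrite ler_wpM2l ?mulr_ge0 ?(ltW e0) //.
  rewrite lef_pV2 ?posrE ?mulr_gt0 ?exprn_gt0 //.
  have -> : 2 * h ^+ 2 * g = 2 * h * (h * g) by ring.
  by rewrite expr2 ler_wpM2l ?ler_pM ?mulr_ge0 ?(ltW h0) ?(ltW g0).
have b_ge' : eps / (4 * H ^+ 3) * b <= eps * b / (4 * h * H ^+ 2).
  rewrite mulrAC ler_wpM2l ?mulr_ge0 ?(ltW e0) //.
  rewrite lef_pV2 ?posrE ?mulr_gt0 ?exprn_gt0 //.
  have -> : 4 * H ^+ 3 = 4 * H * H ^+ 2 by ring.
  by rewrite ler_wpM2r ?exprn_ge0 ?(ltW H0) ?ler_wpM2l.
have : eps * b / (2 * h * H ^+ 2) = eps * b / (4 * h * H ^+ 2)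
  + eps / (2 * H ^+ 2) * b / (2 * h) by field; rewrite hn Hn.
have : 2 * H ^+ 2 / eps * (a / (2 * h)) = a / (eps / (2 * H ^+ 2)) / (2 * h).
  by field; rewrite hn Hn en.
move: q_ge b_ge b_ge'.
rewrite mulNr [(_ + _) / (2 * h)]mulrDl [(p - q) / h]mulrBl.
lra.
Qed.

(* Majorization-minimization: Y k.+1 is stationary, in the directions of P, for
   the quadratic majorizer of wsum at Y k. *)
Lemma irls_is_cvg (R : realType) (I J : finType) (eps : R) (c : I -> R)
    (P : (I -> J -> R) -> Prop) (Y : nat -> I -> J -> R) :
  0 < eps -> (forall i, 0 < c i) -> (forall k l, P (Y k - Y l)) ->
  (forall k Z, P Z -> stationary_step eps c (Y k) (Y k.+1) Z) ->
  forall i j, cvgn (fun k => Y k i j).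
Proof.
move=> e0 c0 PY st i j.
have c0' i' : 0 <= c i' by exact: ltW.
pose F k := wsum eps c (Y k).
pose D k := \sum_i c i * (dotp (Y k i - Y k.+1 i) (Y k i - Y k.+1 i)
   / (2 * smooth eps (Y k i))).
have D0 k : 0 <= D k.
  apply: sumr_ge0 => i' _; rewrite mulr_ge0 // divr_ge0 ?dotp_ge0 //.
  by rewrite mulr_ge0 ?smooth_ge0.
have desc k : F k.+1 + D k <= F k.
  by apply: stationary_step_descent => //; apply: st.
have F_ge0 k : 0 <= F k.
  by apply: sumr_ge0 => i' _; rewrite mulr_ge0 ?smooth_ge0.
have Fdecr : nonincreasing_seq F.
  by apply/nonincreasing_seqP => k; apply: le_trans (desc k); rewrite lerDl.
(* Descent bounds row [i] of every iterate by [F 0 / c i]; the sum over [i] serves as a maximum. *)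
pose H := \sum_i F 0%N / c i.
have YH k i' : smooth eps (Y k i') <= H.
  apply: le_trans (smooth_le_wsum _ _ _ c0) _.
  have /le_trans : F k / c i' <= F 0%N / c i'.
    by rewrite ler_wpM2r ?invr_ge0 ?Fdecr.
  apply; rewrite /H (bigD1 i') //= lerDl.
  by apply: sumr_ge0 => i2 _; rewrite divr_ge0.
have H0 : 0 < H by apply: lt_le_trans (YH 0%N i); exact: smooth_gt0.
have /cvg_ex[Fl Fl_cvg] : cvgn F.
  by apply: nonincreasing_is_cvgn => //; exists 0 => _ [k _ <-].
(* [mu] is the strong convexity modulus seen by the single entry [(i, j)]; [K0] adds up the
   coefficients of the two differences of [F] in [close]. *)
pose mu := eps / (4 * H ^+ 3) * c i; pose K0 := 1 + 2 * H ^+ 2 / eps.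
have mu0 : 0 < mu by rewrite mulr_gt0 // divr_gt0 ?mulr_gt0 ?exprn_gt0.
have t0 : 0 <= 2 * H ^+ 2 / eps.
  by rewrite divr_ge0 ?mulr_ge0 ?exprn_ge0 ?(ltW H0) ?(ltW e0).
have K0_gt0 : 0 < K0 by rewrite ltr_wpDr.
(* Strong convexity from [Y k] towards [Y l], with [D k] replaced by the decrease [F k - F k.+1]. A
   Cauchy estimate for [Y] thus follows from the convergence of [F]. *)
have close k l : mu * (Y l i j - Y k i j) ^+ 2
    <= F l - F k + 2 * H ^+ 2 / eps * (F k - F k.+1).
  have := stationary_step_strong e0 H0 c0' (YH k) (YH l) (st k _ (PY l k)).
  rewrite -/(F k) -/(F l) -/(D k).
  have : mu * (Y l i j - Y k i j) ^+ 2 <= eps / (4 * H ^+ 3) *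
      \sum_i c i * dotp (Y l i - Y k i) (Y l i - Y k i).
    rewrite /mu -(mulrA _ (c i)) ler_pM2l ?divr_gt0 ?mulr_gt0 ?exprn_gt0 //.
    rewrite (bigD1 i) //= -[leLHS]addr0; apply: lerD.
      by rewrite ler_pM2l //; apply: (dotp_le (Y l i - Y k i)).
    by apply: sumr_ge0 => i' _; rewrite mulr_ge0 ?dotp_ge0.
  have : 2 * H ^+ 2 / eps * D k <= 2 * H ^+ 2 / eps * (F k - F k.+1).
    by rewrite ler_wpM2l // lerBrDl.
  move: (_ / eps * D k) (_ / eps * (_ - _)) (mu * _) => a b d.
  by move: (_ * _) => f; lra.
apply: cauchy_sequence_cvgn => e ep.
(* Being this close to the limit makes two tail values of [F] differ by less than [mu * e^2 / K0],
   which [close] turns into [e]. *)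
have dp : 0 < mu * e ^+ 2 / (2 * K0).
  by apply: divr_gt0; apply: mulr_gt0 => //; exact: exprn_gt0.
move/cvgrPdist_lt: Fl_cvg => /(_ _ dp)[K _ hK].
exists K => k l Kk Kl.
have F2 m1 m2 : (K <= m1)%N -> (K <= m2)%N ->
    F m1 - F m2 < mu * e ^+ 2 / K0.
  move=> /hK + /hK/ltr_normlW h2; rewrite distrC => /ltr_normlW h1.
  have : mu * e ^+ 2 / K0 = mu * e ^+ 2 / (2 * K0) + mu * e ^+ 2 / (2 * K0).
    by field; rewrite gt_eqF.
  move: h1 h2 => /=; lra.
have h : mu * (Y l i j - Y k i j) ^+ 2 < mu * e ^+ 2.
  apply: le_lt_trans (close k l) _.
  have -> : mu * e ^+ 2
      = mu * e ^+ 2 / K0 + 2 * H ^+ 2 / eps * (mu * e ^+ 2 / K0).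
    rewrite -{1}[X in X + _]mul1r -mulrDl -/K0 [RHS]mulrC divfK //.
    by rewrite gt_eqF.
  by apply: ltr_leD; [exact: F2|rewrite ler_wpM2l // ltW // F2 // leqW].
move: h; rewrite ltr_pM2l // distrC -real_normK ?num_real // ltr_sqr ?nnegrE //.
exact: ltW.
Qed.

Lemma cvg_sum_fin (R : realType) (I : finType) (f : nat -> I -> R)
    (l : I -> R) :
  (forall i, f k i @[k --> \oo] --> l i) ->
  \sum_i f k i @[k --> \oo] --> \sum_i l i.
Proof.
move=> fl; apply: (@cvg_big _ _ _ _ _ _ _ _ _ (fun i k => f k i)) => //.
exact: add_continuous.
Qed.

Lemma cvg_dotp (R : realType) (J : finType) (y z : nat -> J -> R)
    (yl zl : J -> R) :
  (forall j, y k j @[k --> \oo] --> yl j) ->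
  (forall j, z k j @[k --> \oo] --> zl j) ->
  dotp (y k) (z k) @[k --> \oo] --> dotp yl zl.
Proof. by move=> yc zc; apply: cvg_sum_fin => j; apply: cvgM. Qed.

Lemma cvg_smooth (R : realType) (J : finType) (eps : R) (y : nat -> J -> R)
    (yl : J -> R) :
  (forall j, y k j @[k --> \oo] --> yl j) ->
  smooth eps (y k) @[k --> \oo] --> smooth eps yl.
Proof.
move=> yc.
have h : dotp (y k) (y k) + eps @[k --> \oo] --> dotp yl yl + eps.
  by apply: cvgD; [exact: cvg_dotp|exact: cvg_cst].
exact: (cvg_comp _ _ h (@sqrt_continuous R _)).
Qed.

(* With eps = 0 the tangent inequality, hence the conclusion, needs the limit
   rows to be nonzero. *)
Lemma irls_limit_optimal (R : realType) (I J : finType) (eps : R) (c : I -> R)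
    (Y : nat -> I -> J -> R) (Yl Z : I -> J -> R) :
  0 <= eps -> (forall i, 0 <= c i) ->
  (forall i j, Y k i j @[k --> \oo] --> Yl i j) ->
  (forall i, 0 < smooth eps (Yl i)) ->
  (forall k, stationary_step eps c (Y k) (Y k.+1) Z) ->
  wsum eps c Yl <= wsum eps c (Yl + Z).
Proof.
move=> e0 c0 Yc Yl0 st.
(* The denominators follow [Y k] and the numerators [Y k.+1]; both tend to [Yl], so the limit
   condition is stationarity of [wsum] itself at [Yl] along [Z]. *)
have st_lim : stationary_step eps c Yl Yl Z.
  have : \sum_i c i * (dotp (Y k.+1 i) (Z i) / smooth eps (Y k i)) @[k --> \oo]
     --> \sum_i c i * (dotp (Yl i) (Z i) / smooth eps (Yl i)).
    apply: cvg_sum_fin => i; apply: cvgM; first exact: cvg_cst.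
    apply: cvgM; last by apply: cvgV; [rewrite gt_eqF|exact: cvg_smooth].
    apply: cvg_dotp => j; last exact: cvg_cst.
    by rewrite (cvg_shiftS (fun k => Y k i j)).
  move=> h; apply: (cvg_unique _ h) => //.
  rewrite (_ : (fun k => _) = cst 0); first exact: cvg_cst.
  by apply/funext => k; exact: st.
rewrite -[leLHS]addr0 -[X in _ + X <= _]st_lim -big_split /=.
apply: ler_sum => i _; rewrite -mulrDr ler_wpM2l //.
exact: smooth_tangent.
Qed.

(** * Cholesky factorization and the linear systems *)

Lemma value_csum (R : realType) (n : nat) (f : 'I_n -> counted R) :
  value (csum f) = \sum_i value (f i).
Proof.
rewrite /csum -[RHS]big_enum /=.
by elim: (enum _) => [|i s IH] /=; rewrite ?big_nil // big_cons -IH.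
Qed.

(** The successor is the addition into the accumulator, charged also for the term that is added to
    the initial 0. *)
Lemma cost_csum (R : realType) (n : nat) (f : 'I_n -> counted R) :
  cost (csum f) = (\sum_i (cost (f i)).+1)%N.
Proof.
rewrite /csum -[RHS]big_enum /=.
elim: (enum _) => [|i s IH] /=; rewrite ?big_nil // big_cons IH.
by rewrite addn1 addnC.
Qed.

Lemma value_cmulmx (R : realType) (m n p : nat) (A : 'M[R]_(m, n))
    (B : 'M[R]_(n, p)) : value (cmulmx A B) = A *m B.
Proof. by apply/matrixP => i j; rewrite !mxE value_csum. Qed.

Lemma value_cscale (R : realType) (m n : nat) (a : R) (A : 'M[R]_(m, n)) :
  value (Defs.cscale a A) = a *: A.
Proof. by apply/matrixP => i j; rewrite !mxE. Qed.

Definition posdef (R : realType) (n : nat) (A : 'M[R]_n) : Prop :=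
  A^T = A /\ forall x : 'cV[R]_n, x != 0 -> 0 < (x^T *m A *m x) 0 0.

Lemma posdef_unitmx (R : realType) (n : nat) (A : 'M[R]_n) :
  posdef A -> A \in unitmx.
Proof.
case=> _ pA; rewrite -row_free_unit -kermx_eq0; apply/rowV0P => v.
move=> /sub_kermxP vA; apply/eqP; apply: contraT => v0.
have := pA v^T; rewrite trmxK vA mul0mx mxE ltxx => h.
by apply: h; rewrite trmx_eq0.
Qed.

Lemma posdef_ul (R : realType) (n : nat) (A : 'M[R]_(1 + n)) :
  posdef A -> 0 < ulsubmx A 0 0.
Proof.
case=> _ /(_ (delta_mx (lshift n 0) 0)); rewrite trmx_delta -rowE -colE !mxE.
apply; apply/eqP => /matrixP/(_ (lshift n 0) 0)/eqP.
by rewrite !mxE !eqxx oner_eq0.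
Qed.

(** The form of the Schur complement at [y] is the form of [A] at [(t, y)], where [t] minimizes over
    the first coordinate. *)
Lemma posdef_schur (R : realType) (n : nat) (A : 'M[R]_(1 + n)) :
  posdef A ->
  posdef (drsubmx A
    - (ulsubmx A 0 0)^-1 *: (dlsubmx A *m (dlsubmx A)^T)).
Proof.
move=> pA; have a0 := posdef_ul pA; case: pA => sA pA.
move: sA pA a0; rewrite -[A]submxK.
move: (ulsubmx A) (ursubmx A) (dlsubmx A) (drsubmx A) => a w' w B.
rewrite tr_block_mx => /eq_block_mx[_ ew _ eB].
rewrite block_mxKul block_mxKdl block_mxKdr -{}ew => pA a0.
split; first by rewrite linearB /= linearZ /= trmx_mul trmxK eB.
move=> y y0.
pose t := - ((a 0 0)^-1 *: (w^T *m y)).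
have := pA (col_mx t y).
rewrite col_mx_eq0 (negbTE y0) andbF => /(_ isT).
rewrite tr_col_mx mul_row_block mul_row_col.
have -> : t^T *m a + y^T *m w = 0.
  rewrite [a]mx11_scalar -/(a 0 0) mul_mx_scalar /t linearN /= linearZ /=.
  rewrite trmx_mul trmxK scalerN scalerA divff ?gt_eqF //.
  by rewrite scale1r addNr.
rewrite mul0mx add0r /t linearN /= linearZ /= trmx_mul trmxK mulNmx -scalemxAl.
by rewrite mulmxBr -scalemxAr mulmxA addrC.
Qed.

(** Induction on the size: [d * d] is the pivot, so the program recurses on the Schur complement,
    which is again positive definite; hence each square root is taken of a positive number. *)
Lemma choleskyP (R : realType) (n : nat) (A : 'M[R]_n) : posdef A ->
  [/\ value (cholesky A) *m (value (cholesky A))^T = A,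
      is_trig_mx (value (cholesky A)) &
      forall i, value (cholesky A) i i != 0].
Proof.
elim: n A => [|n IH] A pA.
  by split=> [| |[]//]; [apply/matrixP => -[] | apply/is_trig_mxP => -[]].
have a0 := posdef_ul pA; have pS := posdef_schur pA.
have := IH _ pS; rewrite /=.
set S := (X in cholesky X) in pS *.
set d := Num.sqrt _; set v := (X in block_mx _ _ X _).
have d0 : d != 0 by rewrite gt_eqF // sqrtr_gt0.
have dd : d * d = @ulsubmx R 1 n 1 n A 0 0 by rewrite -expr2 sqr_sqrtr // ltW.
have vE : v = d^-1 *: @dlsubmx R 1 n 1 n A.
  by apply/matrixP => i j; rewrite !mxE mulrC.
have -> : (\matrix_(i, j) (@drsubmx R 1 n 1 n A i j - v i 0 * v j 0)) = S.
  apply/matrixP => i j; rewrite vE /S -dd !mxE big_ord1 !mxE invfM; ring.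
set C := value (cholesky S) => -[CC Ctrig Cd].
have sA : @ursubmx R 1 n 1 n A = (@dlsubmx R 1 n 1 n A)^T.
  by rewrite -{1}pA.1 -trmx_dlsub.
split.
- rewrite (@tr_block_mx R 1 n 1 n) (@mulmx_block R 1 n 1 n 1 n).
  rewrite trmx0 !mulmx0 !mul0mx !addr0 CC.
  rewrite -[RHS](@submxK R 1 n 1 n) tr_scalar_mx -scalar_mxM dd -mx11_scalar.
  rewrite mul_scalar_mx mul_mx_scalar vE linearZ /= !scalerA.
  rewrite divff // !scale1r sA.
  by rewrite -scalemxAl -scalemxAr scalerA -invfM dd addrCA subrr addr0.
- rewrite (@is_trig_block_mx R 1 n 1 n) // eqxx Ctrig andbT /=.
  exact: mx11_is_trig.
- move=> i; rewrite -[i](@splitK 1 n); case: (@fintype.split 1 n i) => j /=.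
    by rewrite (@block_mxEul R 1 n 1 n) !ord1 mxE eqxx.
  by rewrite (@block_mxEdr R 1 n 1 n).
Qed.

Lemma is_trig_submx (R : realType) (n : nat) (C : 'M[R]_(1 + n)) :
  is_trig_mx C -> (forall i, C i i != 0) ->
  [/\ ursubmx C = 0, is_trig_mx (drsubmx C),
      ulsubmx C 0 0 != 0 & forall i, drsubmx C i i != 0].
Proof.
move=> + d; rewrite -{1}[C]submxK is_trig_block_mx // => /and3P[/eqP-> _ ->].
by split=> // [|i]; rewrite !mxE; exact: d.
Qed.

Lemma forward_substP (R : realType) (n : nat) (C : 'M[R]_n) (b : 'cV[R]_n) :
  is_trig_mx C -> (forall i, C i i != 0) ->
  C *m value (forward_subst C b) = b.
Proof.
elim: n C b => [|n IH] C b; first by move=> *; apply/matrixP => -[].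
move=> tC dC; have [ur0 tr c0 d] := is_trig_submx tC dC.
rewrite /= -{1}[C](@submxK R 1 n 1 n) (@mul_block_col R 1 n 1 n 1).
rewrite ur0 mul0mx addr0 IH //.
rewrite -[RHS](@vsubmxK R 1 n 1); apply: (congr2 (@col_mx R 1 n 1)).
  apply/matrixP => i j; rewrite !ord1 mxE big_ord1 !mxE mulr1n.
  by rewrite mulrC divfK //; move: c0; rewrite !mxE.
by apply/matrixP => i j; rewrite !mxE big_ord1 !ord1 !mxE mulr1n addrC subrK.
Qed.

Lemma backward_substP (R : realType) (n : nat) (C : 'M[R]_n) (b : 'cV[R]_n) :
  is_trig_mx C -> (forall i, C i i != 0) ->
  C^T *m value (backward_subst C b) = b.
Proof.
elim: n C b => [|n IH] C b; first by move=> *; apply/matrixP => -[].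
move=> tC dC; have [ur0 tr c0 d] := is_trig_submx tC dC.
rewrite /= -{1}[C](@submxK R 1 n 1 n) (@tr_block_mx R 1 n 1 n).
rewrite (@mul_block_col R 1 n 1 n 1) ur0 trmx0 mul0mx add0r.
rewrite IH // -[RHS](@vsubmxK R 1 n 1).
apply: (congr2 (@col_mx R 1 n 1)) => //.
rewrite value_csum /=; set z := value _.
apply/matrixP => i j; rewrite !ord1 !mxE big_ord1 !mxE mulr1n.
rewrite [X in X + _]mulrC divfK; last by move: c0; rewrite !mxE.
rewrite [X in _ + X](_ : _ = \sum_k @dlsubmx R 1 n 1 n C k 0 * z k 0) ?subrK //.
by apply: eq_bigr => k _; rewrite !mxE.
Qed.

Lemma cholesky_solveP (R : realType) (n : nat) (A : 'M[R]_n) (b : 'cV[R]_n) :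
  posdef A -> value (cholesky_solve A b) = invmx A *m b.
Proof.
move=> pA; have uA := posdef_unitmx pA; have [CC tC dC] := choleskyP pA.
apply: (can_inj (mulKmx uA)); rewrite mulKVmx // -{1}CC -mulmxA.
by rewrite /= backward_substP // forward_substP.
Qed.

(** Both linear systems have this form: Nie's with [B = X] and [d = 1], the accelerated one with
    [B = X^T] and [e = 1]. *)
Lemma quad_gram (R : realType) (m n : nat) (B : 'M[R]_(m, n)) (d : 'rV[R]_m)
    (e : 'rV[R]_n) (a b : R) (x : 'cV[R]_n) :
  (x^T *m (a *: (B^T *m diag_mx d *m B) + b *: diag_mx e) *m x) 0 0
  = a * (\sum_i d 0 i * (B *m x) i 0 ^+ 2) + b * (\sum_j e 0 j * x j 0 ^+ 2).
Proof.
have diagE k (f : 'rV[R]_k) (y : 'cV[R]_k) :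
    (y^T *m diag_mx f *m y) 0 0 = \sum_i f 0 i * y i 0 ^+ 2.
  rewrite mxE; apply: eq_bigr => i _; rewrite mul_mx_diag !mxE; ring.
rewrite mulmxDr mulmxDl -!scalemxAr -!scalemxAl mxE [X in X + _]mxE.
rewrite [X in _ + X]mxE diagE; congr (_ * _ + _).
by rewrite -diagE trmx_mul !mulmxA.
Qed.

(** The form is a sum of two nonnegative parts. If it vanishes at [x], then either [b > 0] and the
    second part forces [x = 0], or both parts vanish, so [M x = 0] and invertibility gives [x = 0].
    The second alternative covers [gamma = 0]. *)
Lemma posdef_gram (R : realType) (m n : nat) (B : 'M[R]_(m, n)) (d : 'rV[R]_m)
    (e : 'rV[R]_n) (a b : R) :
  0 <= a -> 0 <= b -> (forall i, 0 <= d 0 i) -> (forall j, 0 < e 0 j) ->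
  let M := a *: (B^T *m diag_mx d *m B) + b *: diag_mx e in
  0 < b \/ M \in unitmx -> posdef M.
Proof.
move=> a0 b0 d0 e0 M bM; split=> [|x x0].
  rewrite /M linearD /= !linearZ /= !trmx_mul trmxK !tr_diag_mx.
  by rewrite mulmxA.
have s1 i : true -> 0 <= d 0 i * (B *m x) i 0 ^+ 2.
  by move=> _; rewrite mulr_ge0 ?sqr_ge0.
have s2 j : true -> 0 <= e 0 j * x j 0 ^+ 2.
  by move=> _; rewrite mulr_ge0 ?sqr_ge0 // ltW.
rewrite lt_neqAle quad_gram addr_ge0 ?mulr_ge0 ?sumr_ge0 // andbT eq_sym.
apply: contra_neqN x0 => /eqP/eqP.
rewrite paddr_eq0 ?mulr_ge0 ?sumr_ge0 // => /andP[+ +].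
case: bM => [b0'|uM].
  rewrite !mulf_eq0 (gt_eqF b0') /= => _.
  rewrite psumr_eq0 // => /allP h; apply/matrixP => j k; rewrite ord1 mxE.
  have := h j; rewrite mem_index_enum => /(_ isT) /=.
  by rewrite mulf_eq0 gt_eqF //= sqrf_eq0 => /eqP.
move=> h1 h2; apply: (can_inj (mulKmx uM)); rewrite mulmx0 /M.
rewrite mulmxDl -!scalemxAl -!mulmxA.
have -> : a *: (B^T *m (diag_mx d *m (B *m x))) = 0.
  move: h1; rewrite mulf_eq0 => /orP[/eqP->|]; first by rewrite scale0r.
  rewrite psumr_eq0 // => /allP h.
  rewrite (_ : diag_mx d *m _ = 0) ?mulmx0 ?scaler0 //.
  apply/matrixP => i k; rewrite ord1 mul_diag_mx !mxE; apply/eqP.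
  have := h i; rewrite mem_index_enum => /(_ isT) /=.
  by rewrite !mxE !mulf_eq0 orbb.
rewrite add0r.
move: h2; rewrite mulf_eq0 => /orP[/eqP->|]; first by rewrite scale0r.
rewrite psumr_eq0 // => /allP h.
rewrite (_ : diag_mx e *m _ = 0) ?scaler0 //.
apply/matrixP => i k; rewrite ord1 mul_diag_mx !mxE; apply/eqP.
have := h i; rewrite mem_index_enum => /(_ isT) /=.
by rewrite !mulf_eq0 orbb.
Qed.

(** * Weights and linear systems of the two solvers *)

Definition resid (R : realType) (L N : nat) (X : 'M[R]_(L, N)) (A : 'M[R]_N)
  (n : 'I_N) (l : 'I_L) : R := (X - X *m A) l n.

Lemma norm2_row_sqr (R : realType) (m n : nat) (A : 'M[R]_(m, n)) (i : 'I_m) :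
  norm2 (row i A) ^+ 2 = dotp (A i) (A i).
Proof.
rewrite sqr_sqrtr big_ord1.
  by apply: eq_bigr => j _; rewrite mxE expr2.
by apply: sumr_ge0 => j _; exact: sqr_ge0.
Qed.

Lemma norm2_residual_sqr (R : realType) (L N : nat) (X : 'M[R]_(L, N))
    (A : 'M[R]_N) (n : 'I_N) :
  norm2 (residual X A n) ^+ 2 = dotp (resid X A n) (resid X A n).
Proof.
rewrite sqr_sqrtr.
  apply: eq_bigr => i _; rewrite big_ord1 -expr2 /resid /residual !mxE.
  congr ((_ - _) ^+ 2).
  by apply: eq_bigr => j _; rewrite mxE.
by apply: sumr_ge0 => j _; apply: sumr_ge0 => k _; exact: sqr_ge0.
Qed.

Lemma VmxE (R : realType) (N : nat) (eps : R) (A : 'M[R]_N) :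
  Vmx eps A = diag_mx (\row_n (1 / (2 * smooth eps (A n)))).
Proof.
by congr diag_mx; apply/rowP => n; rewrite !mxE norm2_row_sqr.
Qed.

Lemma UwE (R : realType) (L N : nat) (X : 'M[R]_(L, N)) (eps : R)
    (A : 'M[R]_N) (n : 'I_N) :
  Uw X eps A n = 1 / (2 * smooth eps (resid X A n)).
Proof. by rewrite /Uw norm2_residual_sqr. Qed.

Lemma regular_gt0 (R : realType) (L N : nat) (X : 'M[R]_(L, N)) (eps : R)
    (A : 'M[R]_N) : 0 <= eps -> regular X eps A ->
  forall n, 0 < smooth eps (A n) /\ 0 < smooth eps (resid X A n).
Proof.
move=> e0 reg n; have [] := reg n.
rewrite norm2_row_sqr norm2_residual_sqr => h1 h2.
by split; rewrite sqrtr_gt0 lt_neqAle eq_sym ?h1 ?h2 addr_ge0 ?dotp_ge0.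
Qed.

Lemma invmx_diag (R : realType) (n : nat) (d : 'rV[R]_n) :
  (forall i, d 0 i != 0) ->
  diag_mx d \in unitmx /\ invmx (diag_mx d) = diag_mx (\row_i (d 0 i)^-1).
Proof.
move=> d0.
have dd : diag_mx d *m diag_mx (\row_i (d 0 i)^-1) = 1%:M.
  apply/matrixP => i j; rewrite mul_diag_mx !mxE.
  by case: eqP => [->|_]; rewrite ?mulr1n ?mulr0n ?mulr0 // divff.
have u := (mulmx1_unit dd).1; split=> //.
by apply: (can_inj (mulKmx u)); rewrite mulmxV.
Qed.

Lemma invmx_Vmx (R : realType) (L N : nat) (X : 'M[R]_(L, N)) (eps : R)
    (A : 'M[R]_N) : 0 <= eps -> regular X eps A ->
  Vmx eps A \in unitmx /\
  invmx (Vmx eps A) = diag_mx (\row_n (2 * smooth eps (A n))).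
Proof.
move=> e0 reg; rewrite VmxE.
have [|u ->] := @invmx_diag R N (\row_n (1 / (2 * smooth eps (A n)))).
  move=> n; rewrite mxE gt_eqF // divr_gt0 ?mulr_gt0 //.
  exact: (regular_gt0 e0 reg n).1.
split=> //; congr diag_mx; apply/rowP => n; rewrite !mxE.
by rewrite invf_div divr1.
Qed.

Lemma nie_systemE (R : realType) (L N : nat) (X : 'M[R]_(L, N))
    (gamma eps : R) (A : 'M[R]_N) (n : 'I_N) :
  nie_system X gamma eps A n
  = Uw X eps A n *: (X^T *m diag_mx (const_mx 1) *m X) + gamma *: Vmx eps A.
Proof. by rewrite diag_const_mx mulmx1. Qed.

Lemma acc_systemE (R : realType) (L N : nat) (X : 'M[R]_(L, N))
    (gamma eps : R) (A : 'M[R]_N) (n : 'I_N) :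
  0 <= eps -> regular X eps A ->
  acc_system X gamma eps A n
  = Uw X eps A n *: (X^T^T *m diag_mx (\row_n (2 * smooth eps (A n))) *m X^T)
    + gamma *: diag_mx (const_mx 1).
Proof.
move=> e0 reg; rewrite /acc_system (invmx_Vmx e0 reg).2 trmx_mul tr_diag_mx.
by rewrite diag_const_mx trmxK mulmxA.
Qed.

Lemma Uw_gt0 (R : realType) (L N : nat) (X : 'M[R]_(L, N)) (eps : R)
    (A : 'M[R]_N) (n : 'I_N) :
  0 <= eps -> regular X eps A -> 0 < Uw X eps A n.
Proof.
by move=> e0 reg; rewrite UwE divr_gt0 ?mulr_gt0 // (regular_gt0 e0 reg _).2.
Qed.

Lemma posdef_nie_system (R : realType) (L N : nat) (X : 'M[R]_(L, N))
    (gamma eps : R) (A : 'M[R]_N) (n : 'I_N) :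
  0 <= gamma -> 0 <= eps -> regular X eps A ->
  0 < gamma \/ nie_system X gamma eps A n \in unitmx ->
  posdef (nie_system X gamma eps A n).
Proof.
move=> g0 e0 reg; rewrite nie_systemE VmxE => h; apply: posdef_gram => //.
- by rewrite ltW // Uw_gt0.
- by move=> i; rewrite mxE.
- by move=> j; rewrite mxE divr_gt0 ?mulr_gt0 // (regular_gt0 e0 reg _).1.
Qed.

Lemma posdef_acc_system (R : realType) (L N : nat) (X : 'M[R]_(L, N))
    (gamma eps : R) (A : 'M[R]_N) (n : 'I_N) :
  0 <= gamma -> 0 <= eps -> regular X eps A ->
  0 < gamma \/ acc_system X gamma eps A n \in unitmx ->
  posdef (acc_system X gamma eps A n).
Proof.
move=> g0 e0 reg; rewrite acc_systemE // => h; apply: posdef_gram => //.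
- by rewrite ltW // Uw_gt0.
- by move=> i; rewrite mxE mulr_ge0 ?smooth_ge0.
- by move=> j; rewrite mxE.
Qed.

Lemma gamma_gt0_defined (R : realType) (L N : nat) (X : 'M[R]_(L, N))
    (gamma eps : R) (A : 'M[R]_N) :
  0 < gamma -> 0 <= eps -> regular X eps A ->
  nie_defined X gamma eps A /\ acc_defined X gamma eps A.
Proof.
move=> g0 e0 reg; split; split=> // n; apply: posdef_unitmx.
  by apply: posdef_nie_system => //; [exact: ltW|left].
by apply: posdef_acc_system => //; [exact: ltW|left].
Qed.

Lemma acc_column_nie (R : realType) (L N : nat) (X : 'M[R]_(L, N))
    (gamma eps : R) (A : 'M[R]_N) (n : 'I_N) :
  0 <= eps -> nie_defined X gamma eps A -> acc_defined X gamma eps A ->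
  acc_column X gamma eps A n = nie_column X gamma eps A n.
Proof.
move=> e0 [reg nu] [_ au]; rewrite /acc_column /nie_column.
have [uV iV] := invmx_Vmx e0 reg.
(* Multiplying by Nie's system on the left and by the accelerated system on the right clears both
   inverses and leaves the push-through identity. *)
congr (_ *: (_ *m _)); apply: (can_inj (mulKmx (nu n))).
rewrite mulmxA [RHS]mulmxA (mulmxV (nu n)) mul1mx.
apply: (can_inj (mulmxK (au n))); rewrite mulmxKV //.
rewrite trmx_mul; set W := (invmx _)^T.
have -> : W = invmx (Vmx eps A) by rewrite /W iV tr_diag_mx.
rewrite /nie_system /acc_system trmx_mul -/W.
have -> : W = invmx (Vmx eps A) by rewrite /W iV tr_diag_mx.
rewrite mulmxDl mulmxDr -!scalemxAl -!scalemxAr mulmx1 !mulmxA mulmxV // mul1mx.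
by [].
Qed.

(** * The counted programs *)

Lemma value_bind (S T : Type) (c : counted S) (f : S -> counted T) :
  value (bind c f) = value (f (value c)).
Proof. by []. Qed.

Lemma cost_bind (S T : Type) (c : counted S) (f : S -> counted T) :
  cost (bind c f) = (cost c + cost (f (value c)))%N.
Proof. by []. Qed.

Lemma value_ctab (T : Type) (n : nat) (f : 'I_n -> counted T) (i : 'I_n) :
  value (ctab f) i = value (f i).
Proof. by []. Qed.

Lemma value_cweight (R : realType) (n : nat) (eps : R) (y : 'I_n -> R) :
  value (cweight eps y) = 1 / (2 * smooth eps y).
Proof. by rewrite /cweight !value_bind value_csum. Qed.

Lemma value_cVdiag (R : realType) (N : nat) (eps : R) (A : 'M[R]_N) (n : 'I_N) :
  value (cVdiag eps A) n = 1 / (2 * smooth eps (A n)).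
Proof. exact: value_cweight. Qed.

Lemma value_cUdiag (R : realType) (L N : nat) (X : 'M[R]_(L, N)) (eps : R)
    (A : 'M[R]_N) (n : 'I_N) : value (cUdiag X eps A) n = Uw X eps A n.
Proof.
rewrite /cUdiag !value_bind value_cmulmx UwE [LHS]value_cweight.
congr (1 / (2 * smooth _ _)); apply/funext => l.
by rewrite /resid !mxE.
Qed.

(** The assembly step shared by both programs: [w] is [gamma v] for Nie's and constantly [gamma] for
    the accelerated one. *)
Lemma value_scale_shift (R : realType) (n : nat) (a : R) (G : 'M[R]_n)
    (w : 'I_n -> R) :
  value (cmatrix (fun i j =>
    let* g := cmul a (G i j) in
    if i == j then Defs.cadd g (w i) else ret g))
  = a *: G + diag_mx (\row_i w i).
Proof.
apply/matrixP => i j; rewrite !mxE value_bind.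
by case: eqVneq => [->|_] /=; rewrite ?mulr1n // mulr0n addr0.
Qed.

Lemma value_nie_prog (R : realType) (L N : nat) (X : 'M[R]_(L, N))
    (gamma eps : R) (A : 'M[R]_N) :
  0 <= gamma -> 0 <= eps -> nie_defined X gamma eps A ->
  value (nie_prog X gamma eps A) = nie_step X gamma eps A.
Proof.
move=> g0 e0 [reg nu]; rewrite /nie_prog; do 5![rewrite [LHS]value_bind].
rewrite value_cmulmx.
apply/matrixP => i n; rewrite [LHS]mxE [RHS]mxE.
rewrite value_ctab; do 2![rewrite value_bind].
rewrite value_cscale value_cUdiag.
rewrite value_scale_shift.
have -> : Uw X eps A n *: (X^T *m X) + diag_mx (\row_i value (ctab (fun i =>
    cmul gamma (value (cVdiag eps A) i))) i) = nie_system X gamma eps A n.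
  rewrite /nie_system VmxE; congr (_ + _); rewrite -linearZ; congr diag_mx.
  by apply/rowP => j; rewrite !mxE -value_cVdiag.
rewrite cholesky_solveP; last by apply: posdef_nie_system => //; right.
by rewrite /nie_column !colE !mulmxA.
Qed.

Lemma value_acc_prog (R : realType) (L N : nat) (X : 'M[R]_(L, N))
    (gamma eps : R) (A : 'M[R]_N) :
  0 <= gamma -> 0 <= eps -> acc_defined X gamma eps A ->
  value (acc_prog X gamma eps A) = acc_step X gamma eps A.
Proof.
move=> g0 e0 [reg nu]; rewrite /acc_prog; do 5![rewrite [LHS]value_bind].
rewrite value_cmulmx.
set Y := value (cmatrix _).
have -> : Y = X *m invmx (Vmx eps A).
  rewrite (invmx_Vmx e0 reg).2; apply/matrixP => i j.
  rewrite mul_mx_diag [LHS]mxE [RHS]mxE [X in _ = _ * X]mxE.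
  rewrite -[LHS]/(X i j / value (cVdiag eps A) j) value_cVdiag.
  by rewrite invf_div divr1.
apply/matrixP => i n; rewrite [LHS]mxE [RHS]mxE.
rewrite value_ctab; do 3![rewrite value_bind].
rewrite value_cscale value_cUdiag.
rewrite value_cmulmx.
rewrite (value_scale_shift _ _ (fun=> gamma)).
have -> : Uw X eps A n *: (X *m (X *m invmx (Vmx eps A))^T)
    + diag_mx (\row__ gamma) = acc_system X gamma eps A n.
  rewrite /acc_system -diag_const_mx; congr (_ + _); rewrite -linearZ.
  congr diag_mx.
  by apply/rowP => j; rewrite !mxE mulr1.
rewrite cholesky_solveP; last by apply: posdef_acc_system => //; right.
by rewrite /acc_column -mulmxA.
Qed.

(** * Operation counts *)

Lemma cost_cmatrix (R : realType) (m n c : nat)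
    (f : 'I_m -> 'I_n -> counted R) :
  (forall i j, cost (f i j) = c) -> cost (cmatrix f) = (m * n * c)%N.
Proof.
move=> fc /=; under eq_bigr do under eq_bigr do rewrite fc.
by rewrite !sum_nat_const !card_ord mulnA.
Qed.

Lemma cost_csum_const (R : realType) (n c : nat) (f : 'I_n -> counted R) :
  (forall i, cost (f i) = c) -> cost (csum f) = (n * c.+1)%N.
Proof.
move=> fc; rewrite cost_csum; under eq_bigr do rewrite fc.
by rewrite sum_nat_const card_ord.
Qed.

Lemma cost_ctab (T : Type) (n c : nat) (f : 'I_n -> counted T) :
  (forall i, cost (f i) = c) -> cost (ctab f) = (n * c)%N.
Proof.
move=> fc /=; under eq_bigr do rewrite fc.
by rewrite sum_nat_const card_ord.
Qed.

Lemma cost_cmulmx (R : realType) (m n p : nat) (A : 'M[R]_(m, n))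
    (B : 'M[R]_(n, p)) : cost (cmulmx A B) = (m * p * (n * 2))%N.
Proof. by apply: cost_cmatrix => i j; exact: cost_csum_const. Qed.

Lemma cost_cscale (R : realType) (m n : nat) (a : R) (A : 'M[R]_(m, n)) :
  cost (Defs.cscale a A) = (m * n)%N.
Proof. by rewrite (@cost_cmatrix _ _ _ 1) ?muln1. Qed.

Lemma cost_cweight (R : realType) (n : nat) (eps : R) (y : 'I_n -> R) :
  cost (cweight eps y) = (n * 2 + 4)%N.
Proof. by rewrite cost_bind (@cost_csum_const _ _ 1). Qed.

Lemma cost_cVdiag (R : realType) (N : nat) (eps : R) (A : 'M[R]_N) :
  cost (cVdiag eps A) = (N * (N * 2 + 4))%N.
Proof. by apply: cost_ctab => n; exact: cost_cweight. Qed.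

Lemma cost_cUdiag (R : realType) (L N : nat) (X : 'M[R]_(L, N)) (eps : R)
    (A : 'M[R]_N) :
  cost (cUdiag X eps A) = (L * N * (N * 2) + (L * N + N * (L * 2 + 4)))%N.
Proof.
rewrite !cost_bind cost_cmulmx (@cost_cmatrix _ _ _ 1) // muln1.
by rewrite (@cost_ctab _ _ (L * 2 + 4)) // => n; exact: cost_cweight.
Qed.

(** One square root, [m] divisions, and a product and a subtraction for each of the [m^2] entries of
    the Schur complement; both triangles are computed, so the leading term is [2 n^3 / 3]. *)
Fixpoint chol_cost (n : nat) : nat :=
  if n is m.+1 then (1 + m + 2 * m ^ 2 + chol_cost m)%N else 0%N.

Lemma cost_cholesky (R : realType) (n : nat) (A : 'M[R]_n) :
  cost (cholesky A) = chol_cost n.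
Proof.
elim: n A => [//|n IH] A.
rewrite /= IH !sum_nat_const !card_ord; nia.
Qed.

(** The increment [3 m^2 + 3 m + 1] of the cube lies between the cost of one elimination step and
    three times that cost, which gives this bound and the next. *)
Lemma chol_cost_le (n : nat) : (chol_cost n <= n ^ 3)%N.
Proof. by elim: n => [//|n IH] /=; nia. Qed.

Lemma chol_cost_ge (n : nat) : (n ^ 3 <= 3 * chol_cost n)%N.
Proof. by elim: n => [//|n IH] /=; nia. Qed.

Lemma cost_forward_subst (R : realType) (n : nat) (C : 'M[R]_n) (b : 'cV[R]_n) :
  cost (forward_subst C b) = (n ^ 2)%N.
Proof.
elim: n C b => [//|n IH] C b.
rewrite /= IH !sum_nat_const !card_ord; nia.
Qed.

Lemma cost_backward_subst (R : realType) (n : nat) (C : 'M[R]_n)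
    (b : 'cV[R]_n) : cost (backward_subst C b) = (n ^ 2 + n)%N.
Proof.
elim: n C b => [//|n IH] C b.
by rewrite /= IH (@cost_csum_const _ _ 1) //=; nia.
Qed.

Lemma cost_cholesky_solve (R : realType) (n : nat) (A : 'M[R]_n)
    (b : 'cV[R]_n) :
  cost (cholesky_solve A b) = (chol_cost n + (n ^ 2 + (n ^ 2 + n)))%N.
Proof.
by rewrite !cost_bind cost_cholesky cost_forward_subst cost_backward_subst.
Qed.

(** One product per entry and one addition per diagonal entry, [n^2 + n] in all. *)
Definition shift_cost (n : nat) : nat :=
  (\sum_(i < n) \sum_(j < n) (1 + (i == j)))%N.

Lemma shift_cost_le (n : nat) : (shift_cost n <= 2 * n ^ 2)%N.
Proof.
rewrite /shift_cost; apply: (@leq_trans (\sum_(i < n) \sum_(j < n) 2)).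
  by do 2![apply: leq_sum => ? _]; case: eqP.
by rewrite !sum_nat_const !card_ord; nia.
Qed.

Lemma cost_scale_shift (R : realType) (n : nat) (a : R) (G : 'M[R]_n)
    (w : 'I_n -> R) :
  cost (cmatrix (fun i j =>
    let* g := cmul a (G i j) in
    if i == j then Defs.cadd g (w i) else ret g)) = shift_cost n.
Proof.
by apply: eq_bigr => i _; apply: eq_bigr => j _; rewrite cost_bind; case: eqP.
Qed.

Lemma cost_nie_prog (R : realType) (L N : nat) (X : 'M[R]_(L, N))
    (gamma eps : R) (A : 'M[R]_N) :
  cost (nie_prog X gamma eps A) =
  (N * (N * 2 + 4) + (L * N * (N * 2) + (L * N + N * (L * 2 + 4)))
   + N * N * (L * 2) + N
   + N * (shift_cost N + (chol_cost N + (N ^ 2 + (N ^ 2 + N))) + N))%N.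
Proof.
rewrite /nie_prog cost_bind cost_cVdiag cost_bind cost_cUdiag.
rewrite cost_bind cost_cmulmx cost_bind (@cost_ctab _ _ 1) //.
rewrite cost_bind (@cost_ctab _ _
  (shift_cost N + (chol_cost N + (N ^ 2 + (N ^ 2 + N))) + N)); last first.
  move=> n; rewrite cost_bind cost_scale_shift cost_bind cost_cholesky_solve.
  by rewrite cost_cscale muln1 addnA.
by rewrite muln1 /= addn0 !addnA.
Qed.

Lemma cost_acc_prog (R : realType) (L N : nat) (X : 'M[R]_(L, N))
    (gamma eps : R) (A : 'M[R]_N) :
  cost (acc_prog X gamma eps A) =
  (N * (N * 2 + 4) + (L * N * (N * 2) + (L * N + N * (L * 2 + 4)))
   + L * N + L * L * (N * 2)
   + N * (shift_cost L + (chol_cost L + (L ^ 2 + (L ^ 2 + L)))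
          + N * (L * 2) + N))%N.
Proof.
rewrite /acc_prog cost_bind cost_cVdiag cost_bind cost_cUdiag.
rewrite cost_bind (@cost_cmatrix _ _ _ 1) // cost_bind cost_cmulmx.
rewrite cost_bind (@cost_ctab _ _
  (shift_cost L + (chol_cost L + (L ^ 2 + (L ^ 2 + L))) + N * (L * 2) + N));
  last first.
  move=> n; rewrite cost_bind (cost_scale_shift _ _ (fun=> gamma)).
  rewrite cost_bind cost_cholesky_solve cost_bind cost_cmulmx cost_cscale.
  by rewrite !muln1 !addnA.
by rewrite muln1 /= addn0 !addnA.
Qed.

(** With [L <= N] every monomial of the exact count is at most [N^4], and the coefficients add up to
    less than 40. *)
Lemma cost_nie_prog_le (R : realType) (L N : nat) (X : 'M[R]_(L, N))
    (gamma eps : R) (A : 'M[R]_N) : (0 < L)%N -> (L <= N)%N ->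
  (cost (nie_prog X gamma eps A) <= 40 * N ^ 4)%N.
Proof.
move=> L0 LN; rewrite cost_nie_prog.
have := shift_cost_le N; have := chol_cost_le N.
move: (shift_cost N) (chol_cost N) => s c hc hs.
have p k : (k <= 4)%N -> (N ^ k <= N ^ 4)%N.
  by move=> k4; rewrite leq_pexp2l //; lia.
have p1 := p 1 isT; have p2 := p 2 isT; have p3 := p 3 isT.
have q1 : (L * N <= N ^ 2)%N by rewrite leq_mul2r LN orbT.
have q2 : (L * N * N <= N ^ 3)%N by rewrite expnSr leq_mul2r q1 orbT.
have q3 : (N * s <= 2 * N ^ 3)%N by nia.
have q4 : (N * c <= N ^ 4)%N.
  by rewrite [X in (_ <= X)%N]expnS leq_mul2l hc orbT.
move: p1 p2 p3 q1 q2 q3 q4.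
move: (N ^ 4)%N => n4; rewrite !expnS !expn0 !muln1; lia.
Qed.

(** The [N] Cholesky factorizations alone reach this bound. *)
Lemma cost_nie_prog_ge (R : realType) (L N : nat) (X : 'M[R]_(L, N))
    (gamma eps : R) (A : 'M[R]_N) :
  (N ^ 4 <= 3 * cost (nie_prog X gamma eps A))%N.
Proof.
rewrite cost_nie_prog; apply: (@leq_trans (N * (3 * chol_cost N))).
  by rewrite expnS leq_mul2l chol_cost_ge orbT.
by rewrite mulnCA leq_mul2l /=; lia.
Qed.

(** For positive [L] and [N] every monomial is at most [N^2 L] or [N L^3], with coefficients adding
    up to less than 40. *)
Lemma cost_acc_prog_le (R : realType) (L N : nat) (X : 'M[R]_(L, N))
    (gamma eps : R) (A : 'M[R]_N) : (0 < L)%N -> (0 < N)%N ->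
  (cost (acc_prog X gamma eps A) <= 40 * (N ^ 2 * L + N * L ^ 3))%N.
Proof.
move=> L0 N0; rewrite cost_acc_prog.
have := shift_cost_le L; have := chol_cost_le L.
move: (shift_cost L) (chol_cost L) => s c hc hs.
have q3 : (N * s <= 2 * (N * L ^ 2))%N by nia.
have q4 : (N * c <= N * L ^ 3)%N by rewrite leq_mul2l hc orbT.
have q1 : (N * L ^ 2 <= N * L ^ 3)%N by rewrite leq_mul2l leq_pexp2l ?orbT.
have q2 : (N * L <= N ^ 2 * L)%N.
  by rewrite leq_mul2r -{1}(expn1 N) leq_pexp2l ?orbT.
have q5 : (N <= N * L)%N by rewrite leq_pmulr.
have q6 : (N ^ 2 <= N ^ 2 * L)%N by rewrite leq_pmulr.
move: q1 q2 q3 q4 q5 q6; rewrite !expnS !expn0 !muln1; lia.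
Qed.

(** [240 = 40 * 3 * 2]: the factor of the upper bound, that of the lower bound, and one [N^4] for
    each of [N^2 L] and [N L^3]. The extra 1 ensures [L <= N] also for [K = 0]. *)
Lemma acc_speedup (R : realType) (L N K : nat) (X : 'M[R]_(L, N))
    (gamma eps : R) (A : 'M[R]_N) : (0 < L)%N -> (0 < N)%N ->
  ((240 * K + 1) * L <= N)%N ->
  (K * cost (acc_prog X gamma eps A) <= cost (nie_prog X gamma eps A))%N.
Proof.
move=> L0 N0 LN.
have := cost_nie_prog_ge X gamma eps A.
have := cost_acc_prog_le X gamma eps A L0 N0.
move: (cost _) (cost _) => n a ha hn.
rewrite -(leq_pmul2l (isT : (0 < 6)%N)).
have h1 : (240 * K * (N ^ 2 * L) <= N ^ 4)%N.
  apply: (@leq_trans (N ^ 2 * (240 * K * L))); first by rewrite mulnCA.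
  apply: (@leq_trans (N ^ 2 * N)); first by rewrite leq_mul2l; lia.
  by rewrite -expnSr leq_pexp2l.
have LN' : (L <= N)%N by lia.
have h2 : (240 * K * (N * L ^ 3) <= N ^ 4)%N.
  apply: (@leq_trans (N * L ^ 2 * (240 * K * L))).
    by rewrite !expnS !expn0 !muln1; lia.
  apply: (@leq_trans (N * N ^ 2 * N)); last by rewrite -expnS -expnSr.
  by apply: leq_mul; [rewrite leq_mul2l leq_exp2r ?LN' ?orbT | lia].
have h3 : (6 * (K * a) <= 6 * K * (40 * (N ^ 2 * L + N * L ^ 3)))%N.
  by rewrite mulnA leq_mul2l ha orbT.
apply: (leq_trans h3).
move: h1 h2 hn; move: (N ^ 4)%N (_ * L)%N (_ * L ^ 3)%N => x y z; lia.
Qed.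

(** * Global optimality *)

Lemma smoothed_objectiveE (R : realType) (L N : nat) (X : 'M[R]_(L, N))
    (gamma eps : R) (A : 'M[R]_N) :
  smoothed_objective X gamma eps A
  = \sum_n smooth eps (resid X A n) + gamma * \sum_n smooth eps (A n).
Proof.
congr (_ + _ * _); apply: eq_bigr => n _.
  by rewrite norm2_residual_sqr.
by rewrite norm2_row_sqr.
Qed.

(** Lets the limit argument at [eps = 0] speak about the original model. *)
Lemma nie_objectiveE (R : realType) (L N : nat) (X : 'M[R]_(L, N))
    (gamma : R) (A : 'M[R]_N) :
  nie_objective X gamma A = smoothed_objective X gamma 0 A.
Proof.
rewrite smoothed_objectiveE.
have norm2E m n (B : 'M[R]_(m, n)) i : norm2 (row i B) = smooth 0 (B i).
  by rewrite /smooth addr0 -norm2_row_sqr sqrtr_sqr ger0_norm // sqrtr_ge0.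
congr (_ + _ * _); apply: eq_bigr => n _; rewrite norm2E //.
by congr smooth; apply/funext => l; rewrite /resid mxE.
Qed.

Lemma cvg_mx (R : realType) (m n : nat) (A : nat -> 'M[R]_(m, n))
    (B : 'M[R]_(m, n)) :
  (forall i j, A k i j @[k --> \oo] --> B i j) <-> A @ \oo --> B.
Proof.
split=> [h|h i j]; last exact: (cvg_comp _ _ h (@coord_continuous _ _ _ i j B)).
apply/cvg_ballP => e e0.
have : \forall k \near \oo, forall i j, ball (B i j) e (A k i j).
  apply: filter_forall => i; apply: filter_forall => j.
  by move/cvg_ballP: (h i j); exact.
by apply: filterS => k hk; split.
Qed.

(* The rows of A and the residuals x_n - X a_n, padded with zeros to vectors
   over a common index type: smoothed_objective is a weighted sum of the
   smoothed norms of this family. *)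
Definition nie_rows (R : realType) (L N : nat) (X : 'M[R]_(L, N))
    (A : 'M[R]_N) (i : 'I_N + 'I_N) (j : 'I_N + 'I_L) : R :=
  match i, j with
  | inl n, inl m => A n m
  | inr n, inr l => resid X A n l
  | _, _ => 0
  end.

(** The linear part of the affine map [nie_rows X], whence the sign in the residual block. *)
Definition nie_dirs (R : realType) (L N : nat) (X : 'M[R]_(L, N))
    (D : 'M[R]_N) (i : 'I_N + 'I_N) (j : 'I_N + 'I_L) : R :=
  match i, j with
  | inl n, inl m => D n m
  | inr n, inr l => - (X *m D) l n
  | _, _ => 0
  end.

Definition nie_weights (R : realType) (N : nat) (gamma : R)
    (i : 'I_N + 'I_N) : R := if i is inl _ then gamma else 1.

Lemma nie_rowsD (R : realType) (L N : nat) (X : 'M[R]_(L, N)) (A D : 'M[R]_N) :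
  nie_rows X (A + D) = nie_rows X A + nie_dirs X D.
Proof.
apply/funext => i; apply/funext => j.
rewrite -[RHS]/(nie_rows X A i j + nie_dirs X D i j).
case: i j => [n|n] [m|m] /=; rewrite ?addr0 // /resid ?mulmxDr !mxE //.
by rewrite opprD addrA.
Qed.

Lemma nie_rowsB (R : realType) (L N : nat) (X : 'M[R]_(L, N)) (A B : 'M[R]_N) :
  nie_rows X A - nie_rows X B = nie_dirs X (A - B).
Proof.
have {1}-> : A = B + (A - B) by rewrite addrC subrK.
by rewrite nie_rowsD addrAC subrr add0r.
Qed.

Lemma smooth_nie_rows (R : realType) (L N : nat) (X : 'M[R]_(L, N)) (eps : R)
    (A : 'M[R]_N) (n : 'I_N) :
  smooth eps (nie_rows X A (inl n)) = smooth eps (A n) /\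
  smooth eps (nie_rows X A (inr n)) = smooth eps (resid X A n).
Proof.
split; congr (Num.sqrt (_ + _)); rewrite /dotp big_sumType /=.
  by rewrite [X in _ + X]big1 ?addr0 // => l _; rewrite mul0r.
by rewrite [X in X + _]big1 ?add0r // => l _; rewrite mul0r.
Qed.

Lemma wsum_nie_rows (R : realType) (L N : nat) (X : 'M[R]_(L, N))
    (gamma eps : R) (A : 'M[R]_N) :
  wsum eps (nie_weights gamma) (nie_rows X A)
  = smoothed_objective X gamma eps A.
Proof.
rewrite smoothed_objectiveE /wsum big_sumType addrC mulr_sumr.
by congr (_ + _); apply: eq_bigr => n _ /=;
  rewrite ?mul1r ?(smooth_nie_rows X eps A n).1 ?(smooth_nie_rows X eps A n).2.
Qed.

(* The columns of A' solve the linear systems with the weights U, V at A. *)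
Definition normal_eq (R : realType) (L N : nat) (X : 'M[R]_(L, N))
    (gamma eps : R) (A A' : 'M[R]_N) : Prop :=
  forall m n, gamma * (A' m n / smooth eps (A m))
    = (\sum_l X l m * resid X A' n l) / smooth eps (resid X A n).

(** Equation [(m, n)] is multiplied by [D m n] and summed. The left sides give the row block; the
    right sides, once [X] is moved onto [D], give the residual block with the opposite sign. *)
Lemma normal_eq_stationary (R : realType) (L N : nat) (X : 'M[R]_(L, N))
    (gamma eps : R) (A A' D : 'M[R]_N) :
  normal_eq X gamma eps A A' ->
  stationary_step eps (nie_weights gamma) (nie_rows X A) (nie_rows X A')
    (nie_dirs X D).
Proof.
move=> ne; rewrite /stationary_step big_sumType /=.
have -> : \sum_(n < N) gamma * (dotp (nie_rows X A' (inl n))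
      (nie_dirs X D (inl n)) / smooth eps (nie_rows X A (inl n)))
    = \sum_(n < N) \sum_(m < N) D n m * (gamma * (A' n m / smooth eps (A n))).
  apply: eq_bigr => n _; rewrite (smooth_nie_rows X eps A n).1.
  rewrite /dotp big_sumType /=.
  rewrite [X in _ + X]big1 => [|l _]; last by rewrite mul0r.
  rewrite addr0 mulr_suml mulr_sumr; apply: eq_bigr => m _; ring.
have -> : \sum_(n < N) 1 * (dotp (nie_rows X A' (inr n))
      (nie_dirs X D (inr n)) / smooth eps (nie_rows X A (inr n)))
    = - \sum_(n < N) \sum_(m < N)
        D n m * ((\sum_l X l n * resid X A' m l) / smooth eps (resid X A m)).
  rewrite [in RHS]exchange_big -sumrN; apply: eq_bigr => n _.
  rewrite (smooth_nie_rows X eps A n).2 mul1r.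
  rewrite /dotp big_sumType /=.
  rewrite [X in X + _]big1 => [|l _]; last by rewrite mul0r.
  rewrite add0r -sumrN mulr_suml.
  under [RHS]eq_bigr do rewrite mulr_suml mulr_sumr -sumrN.
  rewrite [RHS]exchange_big /=; apply: eq_bigr => l _.
  rewrite mulrN mulNr mxE mulr_sumr mulr_suml -sumrN.
  by apply: eq_bigr => m _; ring.
rewrite -sumrB; apply: big1 => n _; rewrite -sumrB; apply: big1 => m _.
by rewrite ne subrr.
Qed.

Lemma cvg_resid (R : realType) (L N : nat) (X : 'M[R]_(L, N))
    (A : nat -> 'M[R]_N) (B : 'M[R]_N) (n : 'I_N) (l : 'I_L) :
  A @ \oo --> B -> resid X (A k) n l @[k --> \oo] --> resid X B n l.
Proof.
move=> /cvg_mx AB.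
have E (C : 'M[R]_N) : resid X C n l = X l n - \sum_j X l j * C j n.
  by rewrite /resid !mxE.
rewrite E; under eq_fun do rewrite E.
apply: cvgB; first exact: cvg_cst.
by apply: cvg_sum_fin => j; apply: cvgM; [exact: cvg_cst|exact: AB].
Qed.

(** Any competitor [C] is [B] plus the direction [C - B], and the normal equations give stationarity
    in every direction. *)
Lemma normal_eq_limit_optimal (R : realType) (L N : nat) (X : 'M[R]_(L, N))
    (gamma eps : R) (A : nat -> 'M[R]_N) (B : 'M[R]_N) :
  0 <= gamma -> 0 <= eps -> (forall k, normal_eq X gamma eps (A k) (A k.+1)) ->
  A @ \oo --> B -> regular X eps B ->
  is_global_min (smoothed_objective X gamma eps) B.
Proof.
move=> g0 e0 ne AB reg C; rewrite -!wsum_nie_rows -(subrK B C) addrC nie_rowsD.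
apply: (@irls_limit_optimal _ _ _ _ _ (fun k => nie_rows X (A k))) => //.
- by case=> n /=.
- case=> n [j|j] /=; try exact: cvg_cst; last exact: cvg_resid.
  by move/cvg_mx: AB; exact.
- case=> n; have [h1 h2] := regular_gt0 e0 reg n.
    by rewrite (smooth_nie_rows X eps B n).1.
  by rewrite (smooth_nie_rows X eps B n).2.
- by move=> k; exact: normal_eq_stationary.
Qed.

(** For [gamma > 0] all weights are positive, and the entries of [A k] are coordinates of
    [nie_rows X (A k)], so [irls_is_cvg] applies with the range of [nie_dirs X] as directions. *)
Lemma normal_eq_is_cvg (R : realType) (L N : nat) (X : 'M[R]_(L, N))
    (gamma eps : R) (A : nat -> 'M[R]_N) :
  0 < gamma -> 0 < eps -> (forall k, normal_eq X gamma eps (A k) (A k.+1)) ->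
  exists B : 'M[R]_N, A @ \oo --> B.
Proof.
move=> g0 e0 ne.
have Acvg i j : cvgn (fun k => A k i j).
  apply: (@irls_is_cvg _ _ _ eps (nie_weights gamma)
    (fun Z => exists D, Z = nie_dirs X D) (fun k => nie_rows X (A k))
    e0 _ _ _ (inl i) (inl j)).
  - by case.
  - by move=> k l; exists (A k - A l); exact: nie_rowsB.
  - by move=> k _ [D ->]; exact: normal_eq_stationary.
exists (\matrix_(i, j) lim ((fun k => A k i j) @ \oo)).
by apply/cvg_mx => i j; rewrite mxE; exact: Acvg.
Qed.

Lemma regular_eps_gt0 (R : realType) (L N : nat) (X : 'M[R]_(L, N)) (eps : R)
    (A : 'M[R]_N) : 0 < eps -> regular X eps A.
Proof. by move=> e0 n; rewrite !gt_eqF // ltr_wpDl // sqr_ge0. Qed.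

Lemma smooth_le_add (R : realType) (J : finType) (eps : R) (y : J -> R) :
  0 <= eps -> smooth 0 y <= smooth eps y <= smooth 0 y + Num.sqrt eps.
Proof.
move=> e0; rewrite /smooth addr0; apply/andP; split.
  by rewrite ler_sqrt ?addr_ge0 ?dotp_ge0 // lerDl.
rewrite -ler_sqr ?nnegrE ?addr_ge0 ?sqrtr_ge0 //.
rewrite sqrrD !sqr_sqrtr ?addr_ge0 ?dotp_ge0 //.
by rewrite addrAC lerDl mulrn_wge0 // mulr_ge0 ?sqrtr_ge0.
Qed.

(** Each of the [N] residuals, of weight 1, and [N] rows, of weight [gamma], gains at most
    [sqrt eps]. *)
Lemma nie_objective_le_smoothed (R : realType) (L N : nat) (X : 'M[R]_(L, N))
    (gamma eps : R) (A : 'M[R]_N) : 0 <= gamma -> 0 <= eps ->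
  nie_objective X gamma A <= smoothed_objective X gamma eps A
    <= nie_objective X gamma A + N%:R * (1 + gamma) * Num.sqrt eps.
Proof.
move=> g0 e0; rewrite nie_objectiveE !smoothed_objectiveE; apply/andP; split.
  apply: lerD; last apply: ler_wpM2l => //.
    by apply: ler_sum => n _; have /andP[] := smooth_le_add (resid X A n) e0.
  by apply: ler_sum => n _; have /andP[] := smooth_le_add (A n) e0.
have sumD (f : 'I_N -> R) : \sum_n f n + N%:R * Num.sqrt eps
    = \sum_n (f n + Num.sqrt eps).
  by rewrite big_split /= sumr_const card_ord mulr_natl.
have -> : forall a b, a + gamma * b + N%:R * (1 + gamma) * Num.sqrt eps
    = (a + N%:R * Num.sqrt eps) + gamma * (b + N%:R * Num.sqrt eps).
  by move=> a b; ring.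
rewrite !sumD; apply: lerD; last apply: ler_wpM2l => //.
  by apply: ler_sum => n _; have /andP[] := smooth_le_add (resid X A n) e0.
by apply: ler_sum => n _; have /andP[] := smooth_le_add (A n) e0.
Qed.

(** Shared by both solvers. Existence of the limit is a separate premise, because at [gamma = 0]
    each solver needs its own argument for it. *)
Lemma normal_eq_reaches (R : realType) (L N : nat) (X : 'M[R]_(L, N))
    (gamma : R) (step : R -> 'M[R]_N -> 'M[R]_N)
    (defined : R -> 'M[R]_N -> Prop) :
  0 <= gamma ->
  (forall eps A, 0 <= eps -> defined eps A ->
     normal_eq X gamma eps A (step eps A)) ->
  (forall eps A0, 0 < eps -> (forall k, defined eps (run (step eps) A0 k)) ->
     exists B : 'M[R]_N, run (step eps) A0 @ \oo --> B) ->
  reaches_global_optimum X gamma step defined.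
Proof.
move=> g0 ne cv; split.
- move=> eps A0 e0 def; have [B AB] := cv eps A0 e0 def; exists B; split=> //.
  apply: (normal_eq_limit_optimal g0 (ltW e0) _ AB);
    last exact: regular_eps_gt0.
  by move=> k; apply: ne (def k); exact: ltW.
- move=> eta eta0.
  (* The smoothing error is at most [K * sqrt eps], hence at most [eta] once [eps < (eta / K)^2];
     the added 1 makes [K] positive. *)
  pose K := N%:R * (1 + gamma) + 1.
  have K0 : 0 < K by rewrite ltr_wpDl // mulr_ge0 // addr_ge0.
  have d0 : 0 < (eta / K) ^+ 2 by rewrite exprn_gt0 // divr_gt0.
  near=> eps => A0 Aopt def AB B.
  have e0 : 0 < eps by near: eps; exact: nbhs_right_gt.
  have ed : eps < (eta / K) ^+ 2 by near: eps; exact: nbhs_right_lt.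
  have opt : is_global_min (smoothed_objective X gamma eps) Aopt.
    apply: (normal_eq_limit_optimal g0 (ltW e0) _ AB);
      last exact: regular_eps_gt0.
    by move=> k; apply: ne (def k); exact: ltW.
  have /andP[h1 _] := nie_objective_le_smoothed X Aopt g0 (ltW e0).
  have /andP[_ h2] := nie_objective_le_smoothed X B g0 (ltW e0).
  apply: (le_trans h1); apply: (le_trans (opt B)); apply: (le_trans h2).
  rewrite lerD2l; apply: (@le_trans _ _ (K * Num.sqrt eps)).
    by rewrite ler_wpM2r ?sqrtr_ge0 // lerDl.
  rewrite mulrC -ler_pdivlMr //.
  rewrite -[leRHS]ger0_norm ?divr_ge0 ?(ltW eta0) ?(ltW K0) // -sqrtr_sqr.
  by rewrite ler_sqrt ltW.
- move=> A0 B def AB reg C; rewrite !nie_objectiveE.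
  apply: (normal_eq_limit_optimal g0 _ _ AB) => // k.
  exact: ne (def k).
Unshelve. all: by end_near. Qed.

(** * Normal equations of the two updates and convergence of the runs *)

Lemma resid_col (R : realType) (L N : nat) (X : 'M[R]_(L, N)) (A : 'M[R]_N)
    (a : 'I_N -> 'cV[R]_N) (n : 'I_N) (l : 'I_L) :
  (forall i n, A i n = a n i 0) ->
  resid X A n l = (col n X - X *m a n) l 0.
Proof.
move=> Aa; rewrite /resid !mxE; congr (_ - _).
by apply: eq_bigr => j _; rewrite Aa.
Qed.

Lemma half_divE (R : realType) (x h : R) :
  1 / (2 * h) * x = 2^-1 * (x / h).
Proof. by rewrite div1r invfM -mulrA (mulrC h^-1). Qed.

(** Moving [U X^T X a_n] to the right side of the linear system leaves
    [gamma V a_n = U X^T (x_n - X a_n)]; the factors 1/2 in [U] and [V] cancel. *)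
Lemma nie_step_normal_eq (R : realType) (L N : nat) (X : 'M[R]_(L, N))
    (gamma eps : R) (A : 'M[R]_N) :
  nie_defined X gamma eps A -> normal_eq X gamma eps A (nie_step X gamma eps A).
Proof.
move=> [_ nu] m n.
set a := nie_column X gamma eps A.
have aE i k : nie_step X gamma eps A i k = a k i 0 by rewrite mxE.
have : gamma *: (Vmx eps A *m a n)
    = Uw X eps A n *: (X^T *m (col n X - X *m a n)).
  have : nie_system X gamma eps A n *m a n = Uw X eps A n *: (X^T *m col n X).
    by rewrite /a /nie_column -scalemxAr -mulmxA mulKVmx.
  rewrite mulmxBr scalerBr => <-.
  rewrite /nie_system mulmxDl -!scalemxAl mulmxA.
  by rewrite addrAC subrr add0r.
move=> /matrixP/(_ m 0); rewrite VmxE UwE mul_diag_mx.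
rewrite [LHS]mxE [X in _ * X = _]mxE [X in _ * (X * _) = _]mxE [RHS]mxE.
rewrite [X in _ = _ * X]mxE !half_divE mulrCA.
have two : (2^-1 : R) != 0 by rewrite invr_neq0 // pnatr_eq0.
move=> /(mulfI two); rewrite aE => ->; congr (_ / _).
by apply: eq_bigr => l _; rewrite mxE (resid_col _ _ _ aE).
Qed.

(* Z collects the solutions of the L x L systems; it is a Lagrange multiplier
   for the constraint X A = X when gamma = 0. *)
Lemma acc_step_dual (R : realType) (L N : nat) (X : 'M[R]_(L, N))
    (gamma eps : R) (A : 'M[R]_N) :
  0 <= eps -> acc_defined X gamma eps A ->
  exists Z : 'M[R]_(L, N),
    (forall m n, acc_step X gamma eps A m n / smooth eps (A m)
       = (\sum_l X l m * Z l n) / smooth eps (resid X A n)) /\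
    (forall n l, resid X (acc_step X gamma eps A) n l = gamma * Z l n).
Proof.
move=> e0 [reg au].
pose z n := invmx (acc_system X gamma eps A n) *m col n X.
have Sz n : acc_system X gamma eps A n *m z n = col n X by rewrite mulKVmx.
set a := acc_column X gamma eps A.
have aE i k : acc_step X gamma eps A i k = a k i 0 by rewrite mxE.
exists (\matrix_(l, n) z n l 0); split=> [m n|n l].
  have hm := (regular_gt0 e0 reg m).1.
  rewrite aE /a /acc_column -mulmxA -/(z n) (invmx_Vmx e0 reg).2 trmx_mul.
  rewrite tr_diag_mx -mulmxA mul_diag_mx.
  rewrite [X in X / _]mxE [X in _ * X / _]mxE [X in _ * (X * _) / _]mxE UwE.
  rewrite half_divE.
  have -> : (X^T *m z n) m 0 = \sum_l X l m * (\matrix_(l, n) z n l 0) l n.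
    by rewrite mxE; apply: eq_bigr => l _; rewrite !mxE.
  have := (regular_gt0 e0 reg n).2.
  move: (smooth _ _) hm (smooth _ _) (\sum__ _) => h hm g s g0.
  by field; rewrite !gt_eqF.
(* Writing [x_n] as the accelerated system applied to [z n] cancels [X a_n] and leaves
   [gamma z n]. *)
rewrite (resid_col _ _ _ aE) -[X in X - _](Sz n) /a /acc_column -/(z n).
rewrite -mulmxA -/(z n) /acc_system mulmxDl -!scalemxAl mul1mx -scalemxAr.
rewrite !mulmxA.
by rewrite addrAC subrr add0r !mxE.
Qed.

Lemma acc_step_normal_eq (R : realType) (L N : nat) (X : 'M[R]_(L, N))
    (gamma eps : R) (A : 'M[R]_N) :
  0 <= eps ->
  acc_defined X gamma eps A -> normal_eq X gamma eps A (acc_step X gamma eps A).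
Proof.
move=> e0 def m n; have [Z [-> rE]] := acc_step_dual e0 def.
rewrite mulrA mulr_sumr; congr (_ / _).
by apply: eq_bigr => l _; rewrite rE mulrCA.
Qed.

(** The right side [U X^T x_n] is then the [n]-th column of the system matrix [U X^T X], so the
    solution is the [n]-th basis vector. *)
Lemma nie_step_gamma0 (R : realType) (L N : nat) (X : 'M[R]_(L, N))
    (eps : R) (A : 'M[R]_N) :
  nie_defined X 0 eps A -> nie_step X 0 eps A = 1%:M.
Proof.
move=> [_ nu]; apply/matrixP => i n; rewrite mxE.
have -> : nie_column X 0 eps A n = delta_mx n 0.
  apply: (can_inj (mulKmx (nu n))).
  rewrite /nie_column -scalemxAr -[in LHS]mulmxA mulKVmx // colE.
  by rewrite /nie_system scale0r addr0 -scalemxAl mulmxA.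
by rewrite !mxE andbT.
Qed.

Lemma nie_run_is_cvg (R : realType) (L N : nat) (X : 'M[R]_(L, N))
    (gamma eps : R) (A0 : 'M[R]_N) :
  0 <= gamma -> 0 < eps ->
  (forall k, nie_defined X gamma eps (run (nie_step X gamma eps) A0 k)) ->
  exists B : 'M[R]_N, run (nie_step X gamma eps) A0 @ \oo --> B.
Proof.
rewrite le_eqVlt => /predU1P[<-|g0] e0 def; last first.
  by apply: (normal_eq_is_cvg g0 e0) => k; exact: nie_step_normal_eq.
(* For [gamma = 0] the run is constant after its first step; the shift discards [A0]. *)
exists 1%:M; rewrite -cvg_shiftS.
rewrite (_ : (fun k => _) = cst 1%:M); first exact: cvg_cst.
by apply/funext => k; exact: nie_step_gamma0.
Qed.

(* The case gamma = 0: minimization of the smoothed l_{2,1} norm under the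
   constraint X A = X, with multiplier Z. *)
Lemma constrained_is_cvg (R : realType) (L N : nat) (X : 'M[R]_(L, N))
    (eps : R) (A : nat -> 'M[R]_N) :
  0 < eps -> (forall k, X *m A k = X) ->
  (forall k, exists Z : 'M[R]_(L, N), forall m n,
     A k.+1 m n / smooth eps (A k m) = \sum_l X l m * Z l n) ->
  exists B : 'M[R]_N, A @ \oo --> B.
Proof.
move=> e0 XA dual.
have Acvg i j : cvgn (fun k => A k i j).
  (* Only the rows of [A] enter, with weight 1. The directions are the [D] with [X D = 0], against
     which the multiplier term [X^T Z] pairs to zero. *)
  apply: (@irls_is_cvg _ _ _ eps (fun=> 1)
    (fun D => forall l n, \sum_m X l m * D m n = 0)
    (fun k i j => A k i j) e0 _ _ _ i j) => //.
    move=> k k' l n; have /matrixP/(_ l n) : X *m A k - X *m A k' = 0.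
      by rewrite !XA subrr.
    rewrite !mxE -sumrB => h; rewrite -[RHS]h; apply: eq_bigr => m _.
    by rewrite -mulrBr.
  move=> k D XD; have [Z aZ] := dual k.
  rewrite /stationary_step; set S := LHS.
  have -> : S = \sum_m \sum_n D m n * (A k.+1 m n / smooth eps (A k m)).
    apply: eq_bigr => m _; rewrite mul1r /dotp mulr_suml.
    by apply: eq_bigr => n _; ring.
  rewrite exchange_big /=; apply: big1 => n _.
  have -> : \sum_m D m n * (A k.+1 m n / smooth eps (A k m))
    = \sum_l (\sum_m X l m * D m n) * Z l n.
    under [RHS]eq_bigr do rewrite mulr_suml.
    rewrite exchange_big /=; apply: eq_bigr => m _.
    by rewrite aZ mulr_sumr; apply: eq_bigr => l _; ring.
  by apply: big1 => l _; rewrite XD mul0r.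
exists (\matrix_(i, j) lim ((fun k => A k i j) @ \oo)).
by apply/cvg_mx => i j; rewrite mxE; exact: Acvg.
Qed.

Lemma acc_run_is_cvg (R : realType) (L N : nat) (X : 'M[R]_(L, N))
    (gamma eps : R) (A0 : 'M[R]_N) :
  0 <= gamma -> 0 < eps ->
  (forall k, acc_defined X gamma eps (run (acc_step X gamma eps) A0 k)) ->
  exists B : 'M[R]_N, run (acc_step X gamma eps) A0 @ \oo --> B.
Proof.
rewrite le_eqVlt => /predU1P[<-|g0] e0 def; last first.
  apply: (normal_eq_is_cvg g0 e0) => k.
  by apply: acc_step_normal_eq => //; exact: ltW.
(* [A0] may violate [X A = X], but every later iterate satisfies it, its residual being
   [gamma Z = 0]; hence the shift by one. *)
have [k|k|B AB] := @constrained_is_cvg _ _ _ X eps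
  (fun k => run (acc_step X 0 eps) A0 k.+1) e0; last first.
- by exists B; rewrite -cvg_shiftS.
- have [Z [aZ _]] := acc_step_dual (ltW e0) (def k.+1).
  (* The multiplier absorbs the residual weight of column [n]. *)
  exists (\matrix_(l, n)
    (Z l n / smooth eps (resid X (run (acc_step X 0 eps) A0 k.+1) n))).
  move=> m n; rewrite [LHS]aZ mulr_suml; apply: eq_bigr => l _.
  by rewrite [in RHS]mxE mulrA.
- have [Z [_ rE]] := acc_step_dual (ltW e0) (def k).
  apply/eqP; rewrite eq_sym -subr_eq0; apply/eqP/matrixP => l n.
  by rewrite [RHS]mxE -[LHS]/(resid X (acc_step X 0 eps _) n l) rE mul0r.
Qed.

Theorem corollary5 (R : realType) :
  [/\ (* the same solution *)
      forall (L N : nat) (X : 'M[R]_(L, N)) (gamma eps : R),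
        (0 < L)%N -> (0 < N)%N -> 0 <= gamma -> 0 <= eps ->
        [/\ forall A : 'M[R]_N, 0 < gamma -> regular X eps A ->
              nie_defined X gamma eps A /\ acc_defined X gamma eps A,
            forall A : 'M[R]_N,
              nie_defined X gamma eps A -> acc_defined X gamma eps A ->
              forall n, acc_column X gamma eps A n = nie_column X gamma eps A n
          & forall A0 : 'M[R]_N,
              (forall k, nie_defined X gamma eps
                           (run (nie_step X gamma eps) A0 k)) ->
              (forall k, acc_defined X gamma eps
                           (run (acc_step X gamma eps) A0 k)) ->
              forall k, run (acc_step X gamma eps) A0 k
                        = run (nie_step X gamma eps) A0 k],
      (* the programs whose operations are counted compute the updates *)
      forall (L N : nat) (X : 'M[R]_(L, N)) (gamma eps : R) (A : 'M[R]_N),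
        (0 < L)%N -> (0 < N)%N -> 0 <= gamma -> 0 <= eps ->
        (nie_defined X gamma eps A ->
           value (nie_prog X gamma eps A) = nie_step X gamma eps A) /\
        (acc_defined X gamma eps A ->
           value (acc_prog X gamma eps A) = acc_step X gamma eps A),
      (* complexity of one iteration: order N^4 against O(N^2 L + N L^3) *)
      (exists2 C : nat, (0 < C)%N &
         forall (L N : nat) (X : 'M[R]_(L, N)) (gamma eps : R) (A : 'M[R]_N),
           (0 < L)%N -> (0 < N)%N ->
           ((L <= N)%N ->
              (cost (nie_prog X gamma eps A) <= C * N ^ 4)%N /\
              (N ^ 4 <= C * cost (nie_prog X gamma eps A))%N) /\
           (cost (acc_prog X gamma eps A) <= C * (N ^ 2 * L + N * L ^ 3))%N),
      (* arbitrarily large speed-up when L is much smaller than N *)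
      (forall K : nat, exists M : nat,
         forall (L N : nat) (X : 'M[R]_(L, N)) (gamma eps : R) (A : 'M[R]_N),
           (0 < L)%N -> (0 < N)%N -> (M * L <= N)%N ->
           (K * cost (acc_prog X gamma eps A)
              <= cost (nie_prog X gamma eps A))%N)
    & (* global optimality *)
      forall (L N : nat) (X : 'M[R]_(L, N)) (gamma : R),
        (0 < L)%N -> (0 < N)%N -> 0 <= gamma ->
        reaches_global_optimum X gamma (nie_step X gamma)
                               (nie_defined X gamma) /\
        reaches_global_optimum X gamma (acc_step X gamma)
                               (acc_defined X gamma)].
Proof.
split.
- move=> L N X gamma eps _ _ g0 e0; split.
  + by move=> A gp reg; exact: gamma_gt0_defined.
  + by move=> A nd ad n; exact: acc_column_nie.
  + move=> A0 nd ad; elim=> [//|k IH].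
    rewrite [LHS]/(acc_step X gamma eps (run _ A0 k)).
    rewrite [RHS]/(nie_step X gamma eps (run _ A0 k)) IH.
    apply/matrixP => i n; rewrite [LHS]mxE [RHS]mxE acc_column_nie //.
    by rewrite -IH; exact: ad.
- move=> L N X gamma eps A _ _ g0 e0.
  by split=> ?; [exact: value_nie_prog|exact: value_acc_prog].
- exists 40%N => // L N X gamma eps A L0 N0; split=> [LN|].
    split; first exact: cost_nie_prog_le.
    apply: leq_trans (cost_nie_prog_ge X gamma eps A) _.
    by rewrite leq_mul2r orbT.
  exact: cost_acc_prog_le.
- move=> K; exists (240 * K + 1)%N => L N X gamma eps A L0 N0 LN.
  exact: acc_speedup.
- move=> L N X gamma _ _ g0; split; apply: normal_eq_reaches => //.
  + by move=> eps A _ def; exact: nie_step_normal_eq.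
  + by move=> eps A0 e0 def; exact: nie_run_is_cvg.
  + by move=> eps A e0 def; exact: acc_step_normal_eq.
  + by move=> eps A0 e0 def; exact: acc_run_is_cvg.
Qed.
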